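(* Let $X(q)=\dfrac{(q;q^{12})_\infty(q^{11};q^{12})_\infty(q^{12};q^{12})_\infty}{(q;q)_\infty}$ and $Y(q)=\dfrac{(q^5;q^{12})_\infty(q^7;q^{12})_\infty(q^{12};q^{12})_\infty}{(q;q)_\infty}$. For integers $k\ge1$ and $m>1$ define power series (sums over $n\ge0$) \[ \sum\xi_{1,k}(n)q^n=\frac{Y^k(q)}{X^k(q)},\qquad \sum\xi_{m,k}(n)q^n=\frac{X^k(q)Y^k(q^m)}{Y^k(q)X^k(q^m)}\ (m>1),\qquad \sum\xi_4(n)q^n=\frac{Y(q)Y(q^2)}{X(q)X(q^2)}, \] and denote by a prime the coefficient of $q^n$ in the reciprocal of the corresponding series. Then for all $n\ge0$: (i) $\xi_{1,1}(2n+3)=-\xi'_{1,1}(2n+1)$; (ii) $\xi_{1,1}(4n+2)=\xi'_{1,1}(4n)$; (iii) $\xi_{1,1}(6n+2)=\xi'_{1,1}(6n)$; (iv) $\xi_{1,2}(12n+7)=\xi'_{1,2}(12n+3)$; (v) $\xi_{1,2}(24n+12)=\xi'_{1,2}(24n+8)$; (vi) $\xi_{2,1}(2n+3)=-\xi'_{2,1}(2n+1)$; (vii) $\xi_{2,1}(4n+2)=\xi'_{2,1}(4n)$; (viii) $\xi_{2,1}(12n+8)=\xi'_{2,1}(12n+6)$; (ix) $\xi_{2,2}(12n+7)=\xi'_{2,2}(12n+3)$; (x) $\xi_{2,2}(24n+12)=\xi'_{2,2}(24n+8)$; (xi) $\xi_{3,1}(3n+5)=\xi'_{3,1}(3n+1)$;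 (xii) $\xi_{3,1}(6n+8)=-\xi'_{3,1}(6n+4)$; (xiii) $\xi_{3,1}(6n+4)=-\xi'_{3,1}(6n)$; (xiv) $\xi_{3,1}(12n+7)=\xi'_{3,1}(12n+3)$; (xv) $\xi_{3,2}(24n+14)=\xi'_{3,2}(24n+6)$; (xvi) $\xi_{3,2}(36n+25)=\xi'_{3,2}(36n+17)$; (xvii) $\xi_4(12n+15)=-\xi'_4(12n+9)$; (xviii) $\xi_4(12n+7)=-\xi'_4(12n+1)$; (xix) $\xi_4(12n+10)=\xi'_4(12n+4)$; (xx) $\xi_4(12n+11)=-\xi'_4(12n+5)$; (xxi) $\xi_4(24n+13)=\xi'_4(24n+7)$; (xxii) $\xi_4(36n+24)=\xi'_4(36n+18)$.
   Context: $(a;q)_\infty=\prod_{j\ge0}(1-aq^j)$, $q$ a formal variable (or complex with $|q|<1$). $X(q),Y(q)$ are Rogers–Ramanujan type functions with constant term $1$, so all series above and their reciprocals are power series in $q$. *)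

(* Defs.v *)
From mathcomp Require Import all_boot all_order all_algebra.
Set Implicit Arguments.
Unset Strict Implicit.
Unset Printing Implicit Defensive.
Import GRing.Theory.
Local Open Scope ring_scope.

(* f : fps stands for the formal power series \sum_n (f n) q^n. *)
Definition fps := nat -> int.

Definition fps1 : fps := fun n => (n == 0)%:R.

Definition fps_mul (f g : fps) : fps :=
  fun n => \sum_(i < n.+1) f i * g (n - i)%N.

Definition fps_exp (f : fps) (k : nat) : fps := iter k (fps_mul f) fps1.

(* The first n coefficients g_0, ..., g_{n-1} of 1/f, obtained by solving
   \sum_(i <= m) g_i f_{m-i} = (m == 0) for g_m; see fps_mulV. *)
Fixpoint fps_inv_seq (f : fps) (n : nat) : seq int :=
  if n is m.+1 then
    let s := fps_inv_seq f m in
    rcons s ((f 0)^-1 * ((m == 0)%:R - \sum_(i < m) s`_i * f (m - i)%N))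
  else [::].

Definition fps_inv (f : fps) : fps := fun n => (fps_inv_seq f n.+1)`_n.

Definition fps_div (f g : fps) : fps := fps_mul f (fps_inv g).

(* f(q^m), for m > 0 *)
Definition fps_subst (m : nat) (f : fps) : fps :=
  fun n => if (m %| n)%N then f (n %/ m)%N else 0.

(* (q^r; q^s)_oo for r, s > 0: the factors with j > n do not affect the
   coefficient of q^n; see qpoch_stable. *)
Definition qpoch (r s : nat) : fps :=
  fun n => (\prod_(j < n.+1) (1 - 'X^(r + s * j)) : {poly int})`_n.

Definition Xq : fps :=
  fps_div (fps_mul (fps_mul (qpoch 1 12) (qpoch 11 12)) (qpoch 12 12))
          (qpoch 1 1).

Definition Yq : fps :=
  fps_div (fps_mul (fps_mul (qpoch 5 12) (qpoch 7 12)) (qpoch 12 12))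
          (qpoch 1 1).

(* Only meant for m, k > 0. *)
Definition xi (m k : nat) : fps :=
  if m == 1%N then fps_div (fps_exp Yq k) (fps_exp Xq k)
  else fps_div
         (fps_mul (fps_exp Xq k) (fps_subst m (fps_exp Yq k)))
         (fps_mul (fps_exp Yq k) (fps_subst m (fps_exp Xq k))).

Definition xi' (m k : nat) : fps := fps_inv (xi m k).

Definition xi4 : fps :=
  fps_div (fps_mul Yq (fps_subst 2 Yq)) (fps_mul Xq (fps_subst 2 Xq)).

Definition xi4' : fps := fps_inv xi4.

Lemma size_fps_inv_seq f n : size (fps_inv_seq f n) = n.
Proof. by elim: n => //= n IHn; rewrite size_rcons IHn. Qed.

Lemma nth_fps_inv_seq f n i : (i < n)%N -> (fps_inv_seq f n)`_i = fps_inv f i.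
Proof.
elim: n => // n IHn; rewrite ltnS leq_eqVlt => /predU1P[-> // | lt_in].
by rewrite /= nth_rcons size_fps_inv_seq lt_in IHn.
Qed.

Lemma fps_mulV f : f 0 \is a GRing.unit -> fps_mul f (fps_inv f) =1 fps1.
Proof.
move=> f0U n; rewrite /fps_mul (reindex_inj rev_ord_inj) big_ord_recr /=.
rewrite subnn {2}/fps_inv /= nth_rcons size_fps_inv_seq subn0 ltnn eqxx.
rewrite mulVKr //.
under eq_bigr => i _ do
  rewrite subSS subKn ?(ltnW (ltn_ord i)) // mulrC.
under [in X in _ + (_ - X)]eq_bigr => i _ do rewrite nth_fps_inv_seq //.
by rewrite addrC subrK.
Qed.

Lemma qpoch_stable r s n N : (0 < r)%N -> (0 < s)%N -> (n < N)%N ->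
  (\prod_(j < N) (1 - 'X^(r + s * j)) : {poly int})`_n = qpoch r s n.
Proof.
move=> r0 s0; elim: N => // N IHN; rewrite ltnS leq_eqVlt.
move=> /predU1P[-> // | lt_nN]; rewrite big_ord_recr /= mulrBr mulr1 coefB.
rewrite coefMXn IHN // ifT ?subr0 //.
by rewrite (leq_trans lt_nN) // (leq_trans (leq_pmull N s0)) // leq_addl.
Qed.

Lemma fps_mul0 f g : fps_mul f g 0 = f 0 * g 0.
Proof. by rewrite /fps_mul big_ord1. Qed.

Lemma fps_inv0 f : fps_inv f 0 = (f 0)^-1.
Proof. by rewrite /fps_inv /= big_ord0 subr0 mulr1. Qed.

Lemma fps_div0 f g : f 0 = 1 -> g 0 = 1 -> fps_div f g 0 = 1.
Proof. by move=> f0 g0; rewrite /fps_div fps_mul0 fps_inv0 f0 g0 divr1. Qed.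

Lemma fps_exp0 f k : f 0 = 1 -> fps_exp f k 0 = 1.
Proof. by move=> f0; elim: k => //= k IHk; rewrite fps_mul0 f0 IHk mulr1. Qed.

Lemma fps_subst0 m f : fps_subst m f 0 = f 0.
Proof. by rewrite /fps_subst dvdn0 div0n. Qed.

Lemma qpoch0 r s : (0 < r)%N -> qpoch r s 0 = 1.
Proof.
case: r => // r _.
by rewrite /qpoch big_ord1 coefB coef1 coefXn muln0 addn0 subr0.
Qed.

Lemma Xq0 : Xq 0 = 1.
Proof. by apply: fps_div0; rewrite ?fps_mul0 !qpoch0. Qed.

Lemma Yq0 : Yq 0 = 1.
Proof. by apply: fps_div0; rewrite ?fps_mul0 !qpoch0. Qed.

(* Every series inverted above has constant term 1, so fps_mulV applies. *)
Lemma xi0 m k : xi m k 0 = 1.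
Proof.
by rewrite /xi; case: ifP => _;
  apply: fps_div0; rewrite ?fps_mul0 ?fps_subst0 ?fps_exp0 ?Xq0 ?Yq0.
Qed.

Lemma xi40 : xi4 0 = 1.
Proof. by apply: fps_div0; rewrite fps_mul0 fps_subst0 ?Xq0 ?Yq0. Qed.

(* Main.v *)
(** Let [H = q X / Y] and write [f_k] for [(q^k; q^k)_oo].  Every claim says that
    [G - 1/G] or [G + 1/G] has no coefficient in an arithmetic progression, for
    [G] one of [1/H, H/H(q^2), H/H(q^3), 1/(H H(q^2))] or its square.

    The series [Y -+ q X] are 2-dissection images of theta functions that are
    products, so [s - 1 = 1/H + H - 2] and [s + 3 = 1/H + H + 2] are eta
    quotients in [f_1, f_2, f_3, f_4, f_6, f_12], where [s = 1/H + H - 1].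
    Comparing eta quotients in [H(q^2) = - H(q) H(-q)] forces [s(-q) = - s(q)],
    so that [s + 1] and [s - 3] are eta quotients too; the same equation then
    gives [s(q)^2 (s(q^2) - 1) = s(q^2) (s(q^2) + 3)], which determines [s] and
    makes it an eta quotient.  These five eta quotients turn every additive
    relation needed between eta quotients of level 12 into an identity between
    polynomials in [s].  With them the 2-dissection of [1/H - H] and the
    3-dissections of [1/H - H] and [1/H + H], which come from those of [psi] and
    [1/phi(-q)], are explicit.

    Since [F = q/H] satisfies [F(q^2) = F(q) F(-q)], the series for [m = 2] is
    [F(-q)^k] and the last one is [F(q)^2 F(-q)]; for [m = 3] one dissects
    [H/H(q^3) -+ H(q^3)/H], which is bilinear in [1/H -+ H] at [q] and [q^3].
    The components that remain are series in [q^2], multiples of [psi(q)] by a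
    series in [q^3], or multiples of [phi(q) phi(-q^3)], whose even part is a
    series in [q^4]. *)

From HB Require Import structures.
Require Import Defs.
From mathcomp Require Import all_boot all_order all_algebra.
From mathcomp Require Import boolp ring zify.
Set Implicit Arguments.
Unset Strict Implicit.
Unset Printing Implicit Defensive.
Import GRing.Theory.
Local Open Scope ring_scope.

(** * The integral domain of formal power series *)

(** A coefficient of a product involves only finitely many coefficients of the factors, so the ring
    axioms can be borrowed from polynomials through truncations. *)
Lemma fps_mul_coefM (f g : fps) (p q : {poly int}) n :
  (forall i, (i <= n)%N -> p`_i = f i) ->
  (forall i, (i <= n)%N -> q`_i = g i) -> fps_mul f g n = (p * q)`_n.
Proof.
move=> pf qg; rewrite coefM; apply: eq_bigr => i _.
by rewrite pf ?qg ?leq_subr // -ltnS.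
Qed.

Definition trunc n (f : fps) : {poly int} := \poly_(i < n.+1) f i.

Lemma coef_trunc n f i : (i <= n)%N -> (trunc n f)`_i = f i.
Proof. by move=> le_in; rewrite coef_poly ltnS le_in. Qed.

Lemma fps_mul_trunc f g n i : (i <= n)%N ->
  (trunc n f * trunc n g)`_i = fps_mul f g i.
Proof.
move=> le_in; rewrite (@fps_mul_coefM f g (trunc n f) (trunc n g)) // => j ji;
by rewrite coef_trunc // (leq_trans ji).
Qed.

Lemma fpsP (f g : fps) : f =1 g -> f = g.
Proof. exact: funext. Qed.

Definition fps0 : fps := fun=> 0.
Definition fps_opp (f : fps) : fps := fun n => - f n.
Definition fps_add (f g : fps) : fps := fun n => f n + g n.

HB.instance Definition _ := gen_eqMixin fps.
HB.instance Definition _ := gen_choiceMixin fps.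

Fact fps_addA : associative fps_add.
Proof. by move=> f g h; apply: fpsP => n; exact: addrA. Qed.
Fact fps_addC : commutative fps_add.
Proof. by move=> f g; apply: fpsP => n; exact: addrC. Qed.
Fact fps_add0 : left_id fps0 fps_add.
Proof. by move=> f; apply: fpsP => n; exact: add0r. Qed.
Fact fps_addN : left_inverse fps0 fps_opp fps_add.
Proof. by move=> f; apply: fpsP => n; exact: addNr. Qed.
HB.instance Definition _ :=
  GRing.isZmodule.Build fps fps_addA fps_addC fps_add0 fps_addN.

Fact fps_mulC : commutative fps_mul.
Proof.
move=> f g; apply: fpsP => n.
by rewrite -(@fps_mul_trunc f g n) // mulrC fps_mul_trunc.
Qed.
Fact fps_mulA : associative fps_mul.
Proof.
move=> f g h; apply: fpsP => n.
rewrite (@fps_mul_coefM _ _ (trunc n f) (trunc n g * trunc n h)).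
- rewrite mulrA (@fps_mul_coefM _ _ (trunc n f * trunc n g) (trunc n h)) //;
  by move=> i ?; rewrite ?fps_mul_trunc ?coef_trunc.
- by move=> i ?; rewrite coef_trunc.
- by move=> i ?; rewrite fps_mul_trunc.
Qed.
Fact fps_mul1 : left_id fps1 fps_mul.
Proof.
move=> f; apply: fpsP => n.
rewrite (@fps_mul_coefM _ _ 1 (trunc n f)) ?mul1r ?coef_trunc //.
  by move=> i _; rewrite coef1.
by move=> i ?; rewrite coef_trunc.
Qed.
Fact fps_mulDl : left_distributive fps_mul (fps_add : fps -> fps -> fps).
Proof.
move=> f g h; apply: fpsP => n; rewrite /fps_mul /fps_add -big_split /=.
by apply: eq_bigr => i _; rewrite mulrDl.
Qed.
Fact fps1_neq0 : fps1 != fps0.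
Proof. by apply/eqP => /(congr1 (fun f : fps => f 0)) . Qed.
HB.instance Definition _ := GRing.Zmodule_isComNzRing.Build fps
  fps_mulA fps_mulC fps_mul1 fps_mulDl fps1_neq0.

Lemma fcoef0 n : (0 : fps) n = 0. Proof. by []. Qed.
Lemma fcoefD (f g : fps) n : (f + g) n = f n + g n. Proof. by []. Qed.
Lemma fcoefN (f : fps) n : (- f) n = - f n. Proof. by []. Qed.
Lemma fcoefB (f g : fps) n : (f - g) n = f n - g n. Proof. by []. Qed.
Lemma fcoef1 n : (1 : fps) n = (n == 0)%:R. Proof. by []. Qed.
Lemma fcoefM (f g : fps) n : (f * g) n = \sum_(i < n.+1) f i * g (n - i)%N.
Proof. by []. Qed.
Lemma fcoefMn (f : fps) k n : (f *+ k) n = f n *+ k.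
Proof. by elim: k => // k IHk; rewrite !mulrS fcoefD IHk. Qed.
Lemma fcoefM0 (f g : fps) : (f * g) 0 = f 0 * g 0.
Proof. exact: fps_mul0. Qed.
Lemma fcoefX0 (f : fps) k : (f ^+ k) 0 = f 0 ^+ k.
Proof. by elim: k => // k IHk; rewrite !exprS fcoefM0 IHk. Qed.

Definition fps_unit : {pred fps} := fun f => f 0 \is a GRing.unit.
(** On non-units the unit ring interface requires the inverse to be the identity. *)
Definition fps_invr (f : fps) : fps := if f \in fps_unit then fps_inv f else f.

Fact fps_mulVr : {in fps_unit, left_inverse 1 fps_invr *%R}.
Proof.
move=> f fU; rewrite mulrC /fps_invr fU; apply: fpsP.
exact: (fps_mulV fU).
Qed.
Fact fps_unitPl (f g : fps) : g * f = 1 -> fps_unit f.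
Proof.
move=> /(congr1 (fun f : fps => f 0)); rewrite fcoefM0 => gf.
by apply/unitrPr; exists (g 0); rewrite mulrC.
Qed.
Fact fps_invr_out : {in [predC fps_unit], fps_invr =1 id}.
Proof. by move=> f; rewrite inE /= /fps_invr => /negPf ->. Qed.
HB.instance Definition _ :=
  GRing.ComNzRing_hasMulInverse.Build fps fps_mulVr fps_unitPl fps_invr_out.

Lemma unit_fpsE (f : fps) : (f \is a GRing.unit) = (f 0 \is a GRing.unit).
Proof. by []. Qed.

Lemma unit_fps1 (f : fps) : f 0 = 1 -> f \is a GRing.unit.
Proof. by rewrite unit_fpsE => ->. Qed.

Lemma fps_divE (f g : fps) : g 0 = 1 -> fps_div f g = f / g.
Proof.
move=> g0; rewrite /fps_div; congr (fps_mul f _).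
by rewrite [RHS]/(_ ^-1) /= /fps_invr (unit_fps1 g0 : g \in fps_unit).
Qed.

Lemma fps_invE (g : fps) : g 0 = 1 -> fps_inv g = g^-1.
Proof. by move=> g0; rewrite -[RHS]mul1r -fps_divE // /fps_div fps_mul1. Qed.

Lemma fps_expE (f : fps) k : fps_exp f k = f ^+ k.
Proof. by elim: k => //= k ->; rewrite exprS. Qed.

Lemma fcoefV0 (f : fps) : f 0 = 1 -> f^-1 0 = 1.
Proof. by move=> f0; rewrite -fps_invE // fps_inv0 f0. Qed.

(* The order of vanishing is additive. *)
Fact fps_integral (f g : fps) : f * g = 0 -> (f == 0) || (g == 0).
Proof.
move=> fg0; apply/orP; case: (pselect (f = 0)) => [->|f0]; first by left.
case: (pselect (g = 0)) => [->|g0]; first by right.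
have nz (h : fps) : h <> 0 -> exists n, h n != 0.
  move=> hN0; apply: contrapT => hE; apply: hN0; apply: fpsP => n.
  by apply/eqP; apply: contrapT => /negP hn; apply: hE; exists n.
pose i := ex_minn (nz f f0); pose j := ex_minn (nz g g0).
have [] : f i != 0 /\ g j != 0 by rewrite /i /j; do 2 case: ex_minnP.
have fi k : (k < i)%N -> f k = 0.
  rewrite /i; case: ex_minnP => m _ mm km; apply/eqP; apply: contraTT km.
  by move=> /mm; rewrite -leqNgt.
have gj k : (k < j)%N -> g k = 0.
  rewrite /j; case: ex_minnP => m _ mm km; apply/eqP; apply: contraTT km.
  by move=> /mm; rewrite -leqNgt.
move=> /negPf fi0 /negPf gj0; have := congr1 (fun h : fps => h (i + j)%N) fg0.
have lt_i : (i < (i + j).+1)%N by rewrite ltnS leq_addr.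
rewrite fcoefM (bigD1 (Ordinal lt_i)) //= addKn big1 ?addr0.
  by move=> /eqP; rewrite fcoef0 mulf_eq0 fi0 gj0.
move=> [k lt_k] /eqP/= nk; case: (ltngtP k i) => [ki|ik|ki]; first by rewrite fi ?mul0r.
  by rewrite gj ?mulr0 // ltn_subLR ?ltn_add2r // -ltnS.
by case: nk; apply: val_inj.
Qed.
HB.instance Definition _ := GRing.ComUnitRing_isIntegral.Build fps fps_integral.

(** * Truncation, infinite products and substitutions *)

HB.lock Definition q : fps := fun n => (n == 1)%:R.

Lemma coef_q n : q n = (n == 1)%:R. Proof. by rewrite q.unlock. Qed.

Lemma coef_qM (f : fps) n : (q * f) n = if n is m.+1 then f m else 0.
Proof.
rewrite fcoefM; case: n => [|n]; first by rewrite big_ord1 coef_q mul0r.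
rewrite big_ord_recl coef_q mul0r add0r big_ord_recl /= coef_q mul1r subn1 /=.
by rewrite big1 ?addr0 // => i _; rewrite coef_q mul0r.
Qed.

Lemma coef_qXM k (f : fps) n :
  (q ^+ k * f) n = if (n < k)%N then 0 else f (n - k)%N.
Proof.
elim: k n => [|k IHk] n; first by rewrite mul1r subn0.
by rewrite exprS -mulrA coef_qM; case: n => // n; rewrite IHk ltnS subSS.
Qed.

Lemma coef_qX k n : (q ^+ k) n = (n == k)%:R.
Proof.
rewrite -[_ ^+ _]mulr1 coef_qXM fcoef1 subn_eq0 eqn_leq.
by case: ltnP => le; rewrite ?andbT // andbF.
Qed.

Lemma q_neq0 : q != 0.
Proof. by apply/eqP => /(congr1 (fun f : fps => f 1%N)); rewrite coef_q. Qed.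

(** Congruence modulo [q ^ n]; every limit below is taken in this q-adic sense. *)
Definition eqm n (f g : fps) := forall i, (i < n)%N -> f i = g i.

Lemma eqm_refl n f : eqm n f f. Proof. by []. Qed.
Lemma eqm_sym n f g : eqm n f g -> eqm n g f.
Proof. by move=> fg i ?; rewrite fg. Qed.
Lemma eqm_trans n f g h : eqm n f g -> eqm n g h -> eqm n f h.
Proof. by move=> fg gh i ?; rewrite fg ?gh. Qed.
Lemma eqmW m n f g : (m <= n)%N -> eqm n f g -> eqm m f g.
Proof. by move=> mn fg i im; apply: fg; apply: leq_trans mn. Qed.
Lemma eqmP f g : (forall n, eqm n f g) -> f = g.
Proof. by move=> fg; apply: fpsP => n; apply: (fg n.+1). Qed.

Lemma eqmM n f f' g g' : eqm n f f' -> eqm n g g' -> eqm n (f * g) (f' * g').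
Proof.
move=> ff' gg' i lt_in; rewrite !fcoefM; apply: eq_bigr => j _.
by rewrite ff' ?gg' // (leq_ltn_trans _ lt_in) ?leq_subr // -ltnS.
Qed.
Lemma eqmD n f f' g g' : eqm n f f' -> eqm n g g' -> eqm n (f + g) (f' + g').
Proof. by move=> ff' gg' i lt_in; rewrite !fcoefD ff' ?gg'. Qed.
Lemma eqm_prod n I (r : seq I) (P : pred I) (F G : I -> fps) :
  (forall i, P i -> eqm n (F i) (G i)) ->
  eqm n (\prod_(i <- r | P i) F i) (\prod_(i <- r | P i) G i).
Proof. by move=> FG; elim/big_ind2: _ => // *; apply: eqmM. Qed.

Lemma eqmX0 (c : fps) k : c 0 = 0 -> eqm k (c ^+ k) 0.
Proof.
move=> c0; elim: k => // k IHk i; rewrite ltnS => le_ik.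
rewrite exprS fcoefM big1 // => -[[|j] lt_j] _ /=; first by rewrite c0 mul0r.
by rewrite IHk ?mulr0 //; lia.
Qed.

Lemma eqm_cancel n (f f' g : fps) : g 0 = 1 -> eqm n (f * g) (f' * g) -> eqm n f f'.
Proof.
move=> /unit_fps1 gU fg; rewrite -(mulrK gU f) -(mulrK gU f').
exact: eqmM.
Qed.

(* Meaningful when [g j = 1] modulo [q ^ j]. *)
Definition iprod (g : nat -> fps) : fps := fun n => (\prod_(j < n.+1) g j) n.

Definition converges (g : nat -> fps) := forall j, eqm j (g j) 1.

Lemma iprodP g n : converges g -> eqm n (iprod g) (\prod_(j < n) g j).
Proof.
move=> gP i; elim: n => // n IHn; rewrite ltnS leq_eqVlt.
move=> /predU1P[-> // | lt_in]; rewrite big_ord_recr /= IHn //.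
rewrite -[X in X i = _]mulr1.
exact: eqmM (@eqm_refl n _) (eqm_sym (gP n)) i lt_in.
Qed.

(** Comparing partial products of arbitrarily large lengths is enough, which allows the factors to
    be regrouped in blocks. *)
Lemma iprod_eqP g f : converges g ->
  (forall n, exists2 m, (n <= m)%N & eqm n f (\prod_(j < m) g j)) -> f = iprod g.
Proof.
move=> gP fP; apply: eqmP => n; have [m le_nm fE] := fP n.
by apply: eqm_trans fE (eqm_sym _); apply: eqmW le_nm (iprodP gP).
Qed.

Lemma convergesM g h : converges g -> converges h ->
  converges (fun j => g j * h j).
Proof. by move=> gP hP j; rewrite -[1]mulr1; apply: eqmM. Qed.

Lemma iprodM g h : converges g -> converges h ->
  iprod g * iprod h = iprod (fun j => g j * h j).
Proof.
move=> gP hP; apply: iprod_eqP => [|n]; first exact: convergesM.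
by exists n => //; rewrite big_split /=; apply: eqmM; apply: iprodP.
Qed.

Lemma prod_split (g : nat -> fps) m n :
  \prod_(j < m * n) g j = \prod_(r < m) \prod_(j < n) g (m * j + r)%N.
Proof.
elim: n => [|n IHn].
  by rewrite muln0 big_ord0 big1 // => r _; rewrite big_ord0.
rewrite mulnS addnC big_split_ord /= IHn -big_split /=.
by apply: eq_bigr => r _; rewrite big_ord_recr.
Qed.

Lemma iprod_split g m : (0 < m)%N -> converges g ->
  iprod g = \prod_(r < m) iprod (fun j => g (m * j + r)%N).
Proof.
move=> m0 gP; apply/esym/iprod_eqP => // n; exists (m * n)%N.
  exact: leq_pmull.
rewrite prod_split; apply: eqm_prod => r _; apply: iprodP => j.
by apply: eqmW (gP _); rewrite (leq_trans (leq_pmull j m0)) ?leq_addr.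
Qed.

(** A q-adically continuous ring morphism commutes with infinite products; this serves both
    [q -> q^m] and [q -> -q]. *)
Lemma rmorph_iprod (h : {rmorphism fps -> fps}) g :
  (forall n f f', eqm n f f' -> eqm n (h f) (h f')) -> converges g ->
  h (iprod g) = iprod (fun j => h (g j)).
Proof.
move=> hP gP; apply: iprod_eqP => [j|n].
  by rewrite -(rmorph1 h); apply: hP.
by exists n => //; rewrite -rmorph_prod; apply: hP; apply: iprodP.
Qed.

(** * The substitutions [q -> q^m] and [q -> -q] *)

Fact fps_subst_is_zmod_morphism m : zmod_morphism (fps_subst m).
Proof.
move=> f g; apply: fpsP => n; rewrite !fcoefB /fps_subst.
by case: ifP.
Qed.
Fact fps_subst_is_monoid_morphism m : monoid_morphism (fps_subst m).
Proof.
split.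
  apply: fpsP => n; rewrite /fps_subst !fcoef1; case: ifP => [/dvdnP[k ->]|mn].
    by case: m => [|m]; rewrite ?muln0 // mulnK // muln_eq0 orbF.
  by case: n mn => //; rewrite dvdn0.
move=> f g; apply: fpsP => n; rewrite {1}/fps_subst [RHS]fcoefM.
(* For [m = 0] the substitution keeps only the constant term, which is still multiplicative. *)
case: (posnP m) => [->|m0].
  rewrite dvd0n divn0; case: n => [|n] /=; first by rewrite fcoefM0 big_ord1 !fps_subst0.
  rewrite big1 // => -[[|i] lt_i] _.
    by rewrite /fps_subst subn0 !dvd0n mulr0.
  by rewrite /fps_subst !dvd0n mul0r.
case: ifP => [/dvdnP[k ->]|mn]; last first.
  rewrite big1 // => i _; rewrite /fps_subst; case: ifP => mi; last by rewrite mul0r.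
  case: ifP => mni; rewrite ?mulr0 //.
  by have := dvdn_add mni mi; rewrite subnK ?leq_ord // mn.
rewrite mulnK // fcoefM.
(* Only indices divisible by [m] contribute; they are the [i * m] with [i <= k]. *)
transitivity (\sum_(i < (k * m).+1 | (m %| i)%N) fps_subst m f i * fps_subst m g (k * m - i)%N); last first.
  rewrite [RHS](bigID (fun i : 'I_ _ => (m %| i)%N)) /= [X in _ = _ + X]big1 ?addr0 //.
  by move=> i /negPf mi; rewrite /fps_subst mi mul0r.
have inj (i : 'I_k.+1) : (i * m < (k * m).+1)%N by rewrite ltnS leq_pmul2r // -ltnS.
rewrite (reindex_onto (fun i : 'I_k.+1 => Ordinal (inj i)) (fun i => inord (i %/ m))) /=; last first.
  move=> i mi; apply: val_inj => /=; rewrite inordK ?divnK //.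
  by rewrite ltnS leq_divLR // -ltnS.
apply: eq_big => [i|i _]; rewrite ?dvdn_mull //= ?mulnK //.
  by apply/esym/eqP/val_inj; rewrite /= inordK.
by rewrite /fps_subst -mulnBl !dvdn_mull // !mulnK.
Qed.
HB.instance Definition _ m :=
  GRing.isZmodMorphism.Build fps fps (fps_subst m) (@fps_subst_is_zmod_morphism m).
HB.instance Definition _ m :=
  GRing.isMonoidMorphism.Build fps fps (fps_subst m) (@fps_subst_is_monoid_morphism m).
Notation V := fps_subst.

Lemma coef_VM m f n : (0 < m)%N -> V m f (m * n)%N = f n.
Proof. by move=> m0; rewrite /V dvdn_mulr // mulKn. Qed.
Lemma coef_Vr m f n r : (0 < r < m)%N -> V m f (m * n + r)%N = 0.
Proof.
by move=> /andP[r0 rm]; rewrite /V dvdn_addr ?dvdn_mulr // gtnNdvd.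
Qed.

Lemma V_eqm m n f f' : eqm n f f' -> eqm n (V m f) (V m f').
Proof.
move=> ff' i lt_in; rewrite /V; case: ifP => // _; apply: ff'.
exact: leq_ltn_trans (leq_div _ _) lt_in.
Qed.

Lemma V0 m (f : fps) : V m f 0 = f 0. Proof. exact: fps_subst0. Qed.

Lemma Vcomp m n f : V m (V n f) = V (m * n)%N f.
Proof.
apply: fpsP => i; rewrite /V; case: (posnP m) => [->|m0].
  rewrite mul0n !dvd0n divn0; case: (i == 0) => //.
  by rewrite dvdn0 div0n.
case: ifP => [/dvdnP[k ->]|mi].
  by rewrite mulnK // (mulnC m) dvdn_pmul2r // divnMr.
by case: ifP => // mni; rewrite (dvdn_trans (dvdn_mulr n (dvdnn m)) mni) in mi.
Qed.

Lemma Vinj m : (0 < m)%N -> injective (V m).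
Proof.
by move=> m0 f g fg; apply: fpsP => n; rewrite -(coef_VM f n m0) fg coef_VM.
Qed.

Lemma Vq m : (0 < m)%N -> V m q = q ^+ m.
Proof.
move=> m0; apply: fpsP => n; rewrite coef_qX /V coef_q.
case: ifP => [/dvdnP[k ->]|mn]; last by case: eqP mn => // ->; rewrite dvdnn.
by rewrite mulnK // -{2}[m]mul1n eqn_pmul2r.
Qed.

Definition fps_neg (f : fps) : fps := fun n => (-1) ^+ n * f n.
Fact fps_neg_is_zmod_morphism : zmod_morphism fps_neg.
Proof. by move=> f g; apply: fpsP => n; rewrite !fcoefB /fps_neg mulrBr. Qed.
Fact fps_neg_is_monoid_morphism : monoid_morphism fps_neg.
Proof.
split.
  by apply: fpsP => -[|n]; rewrite /fps_neg !fcoef1 /= ?mulr1 ?mulr0.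
move=> f g; apply: fpsP => n; rewrite {1}/fps_neg !fcoefM mulr_sumr.
apply: eq_bigr => i _; rewrite /fps_neg mulrACA -exprD subnKC //.
exact: leq_ord.
Qed.
HB.instance Definition _ :=
  GRing.isZmodMorphism.Build fps fps fps_neg fps_neg_is_zmod_morphism.
HB.instance Definition _ :=
  GRing.isMonoidMorphism.Build fps fps fps_neg fps_neg_is_monoid_morphism.
Notation N := fps_neg.

Lemma N_eqm n f f' : eqm n f f' -> eqm n (N f) (N f').
Proof. by move=> ff' i lt_in; rewrite /N ff'. Qed.
Lemma N0 (f : fps) : N f 0 = f 0. Proof. by rewrite /N mul1r. Qed.
Lemma NK : involutive N.
Proof. by move=> f; apply: fpsP => n; rewrite /N mulrA -expr2 sqrr_sign mul1r. Qed.
Lemma Nq : N q = - q.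
Proof. by apply: fpsP => -[|[|n]]; rewrite fcoefN /N coef_q /= ?mulr0 ?mulr1 ?oppr0. Qed.

Lemma NV_even m f : ~~ odd m -> N (V m f) = V m f.
Proof.
move=> m2; apply: fpsP => n; rewrite /N /V; case: ifP => [mn|]; last by rewrite mulr0.
by rewrite -signr_odd (negPf (contra (dvdn_odd mn) m2)) mul1r.
Qed.
Lemma NV_odd m f : odd m -> N (V m f) = V m (N f).
Proof.
move=> m1; apply: fpsP => n; rewrite /N /V; case: ifP => [/dvdnP[k ->]|]; last by rewrite mulr0.
by rewrite mulnK ?odd_gt0 // -signr_odd oddM m1 andbT signr_odd.
Qed.

(** * q-shifted factorials and theta functions *)

(** The product $(a; c)_\infty$. Only [c] must have zero constant term, so that [a = -1] is allowed,
    as needed for [theta 1 q]. *)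
HB.lock Definition poch (a c : fps) := iprod (fun j => 1 - a * c ^+ j).
Lemma pochE a c : poch a c = iprod (fun j => 1 - a * c ^+ j).
Proof. by rewrite poch.unlock. Qed.

Lemma poch_converges (a c : fps) : c 0 = 0 -> converges (fun j => 1 - a * c ^+ j).
Proof.
move=> c0 j i lt_ij; rewrite fcoefB.
have -> : (a * c ^+ j) i = (a * 0) i by exact: eqmM (@eqm_refl j a) (eqmX0 c0) i lt_ij.
by rewrite mulr0 subr0.
Qed.

Lemma pochP (a c : fps) n : c 0 = 0 -> eqm n (poch a c) (\prod_(j < n) (1 - a * c ^+ j)).
Proof. by move=> c0; rewrite pochE; apply: iprodP (poch_converges a c0). Qed.

Lemma poch0 (a c : fps) : c 0 = 0 -> a 0 = 0 -> poch a c 0 = 1.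
Proof.
move=> c0 a0; rewrite (@pochP _ _ 1 c0) // big_ord1 fcoefB fcoefM0 a0 mul0r.
by rewrite subr0.
Qed.

Lemma pochMN (a c : fps) : c 0 = 0 -> poch a c * poch (- a) c = poch (a ^+ 2) (c ^+ 2).
Proof.
move=> c0; rewrite !pochE iprodM; try exact: poch_converges.
congr iprod; apply: funext => j; rewrite exprAC; ring.
Qed.

Lemma poch_split m (a c : fps) : (0 < m)%N -> c 0 = 0 ->
  poch a c = \prod_(r < m) poch (a * c ^+ r) (c ^+ m).
Proof.
move=> m0 c0; rewrite pochE (iprod_split m0 (poch_converges a c0)).
apply: eq_bigr => r _; rewrite pochE; congr iprod; apply: funext => j.
by rewrite -mulrA -exprM -exprD addnC.
Qed.

Lemma V_poch m (a c : fps) : c 0 = 0 -> V m (poch a c) = poch (V m a) (V m c).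
Proof.
move=> c0; rewrite !pochE rmorph_iprod; [|exact: V_eqm|exact: poch_converges].
by congr iprod; apply: funext => j; rewrite rmorphB rmorph1 rmorphM rmorphXn.
Qed.

Lemma N_poch (a c : fps) : c 0 = 0 -> N (poch a c) = poch (N a) (N c).
Proof.
move=> c0; rewrite !pochE rmorph_iprod; [|exact: N_eqm|exact: poch_converges].
by congr iprod; apply: funext => j; rewrite rmorphB rmorph1 rmorphM rmorphXn.
Qed.

Definition fps_of_poly (p : {poly int}) : fps := fun n => p`_n.
Lemma fps_of_polyM p r : fps_of_poly (p * r) = fps_of_poly p * fps_of_poly r.
Proof. by apply: fpsP => n; rewrite /fps_of_poly coefM. Qed.

Lemma qpochE r s : (0 < s)%N -> qpoch r s = poch (q ^+ r) (q ^+ s).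
Proof.
move=> s0; apply: fpsP => n; rewrite /qpoch pochE /iprod.
rewrite -[LHS]/(fps_of_poly _ n); congr (_ n).
elim: n.+1 => [|k IHk].
  by rewrite !big_ord0; apply: fpsP => i; rewrite /fps_of_poly coef1.
rewrite !big_ord_recr /= fps_of_polyM IHk.
suff -> : fps_of_poly (1 - 'X^(r + s * k)) = 1 - q ^+ r * (q ^+ s) ^+ k by [].
apply: fpsP => i; by rewrite /fps_of_poly coefB coef1 coefXn fcoefB fcoef1 -exprM -exprD coef_qX.
Qed.

(** * The q-binomial theorem, theta functions and the triple product *)

Fixpoint qbin (c : fps) n k : fps :=
  if k isn't k'.+1 then 1 else
  if n isn't n'.+1 then 0 else qbin c n' k' + c ^+ k * qbin c n' k.

Lemma qbin_small c n k : (n < k)%N -> qbin c n k = 0.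
Proof.
elim: n k => [|n IHn] [|k] //=; rewrite ltnS => lt_nk.
by rewrite !IHn ?mulr0 ?addr0 // (leq_trans lt_nk).
Qed.

(** The q-binomial theorem; the Gaussian binomial [qbin] is given by its Pascal rule, so no division
    occurs. The induction takes out the factor [i = 0] and replaces [y] by [y * c]. *)
Lemma qbin_qpow (c : fps) m x y :
  \prod_(i < m) (x + y * c ^+ i) =
  \sum_(k < m.+1) qbin c m k * c ^+ 'C(k, 2) * x ^+ (m - k) * y ^+ k.
Proof.
elim: m y => [|m IHm] y; first by rewrite big_ord0 big_ord1 !mul1r.
rewrite big_ord_recl expr0 mulr1.
under eq_bigr => i _ do rewrite exprS mulrA.
rewrite IHm big_distrr /=.
under eq_bigr => k _ do rewrite mulrDl.
rewrite big_split /= [RHS]big_ord_recl.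
under [in RHS]eq_bigr => k _ do rewrite /= !mulrDl.
rewrite big_split /= big_ord_recl [X in _ = _ + (_ + X)]big_ord_recr /=.
rewrite [qbin c m (bump 0 m)]qbin_small // mulr0 !mul0r addr0 -!addrA; congr (_ + _).
  rewrite !subn0 (_ : qbin c m 0 = 1); last by case: (m).
  by rewrite !mul1r !expr0 !mulr1 exprS.
rewrite addrC; congr (_ + _); apply: eq_bigr => k _; rewrite /bump /= add1n.
  by rewrite add0n subSS binS bin1 [y ^+ _.+1]exprS exprD exprMn; ring.
rewrite subSS -(subnSK (ltn_ord k)) exprMn.
by rewrite [x ^+ (_ - _).+1]exprS; ring.
Qed.

Definition qfac (c : fps) n := \prod_(i < n) (1 - c * c ^+ i).

Lemma qfacS c n : qfac c n.+1 = qfac c n * (1 - c ^+ n.+1).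
Proof. by rewrite /qfac big_ord_recr exprS. Qed.

(** The quotient formula for Gaussian binomials without division; it yields their limit in the
    triple product. *)
Lemma qbin_fac c n k : (k <= n)%N ->
  qbin c n k * (qfac c k * qfac c (n - k)) = qfac c n.
Proof.
elim: n k => [|n IHn] [|k] //=; rewrite ?[qfac c 0]big_ord0 ?mul1r ?mulr1 //.
rewrite ltnS => le_kn; rewrite subSS.
(* For [k = n] both sides vanish: the binomial is zero and so is [1 - c ^ 0]. *)
have kE : qbin c n k.+1 * (qfac c k.+1 * qfac c (n - k)) =
    qfac c n * (1 - c ^+ (n - k)).
  have [lt_kn|le_nk] := ltnP k n.
    by rewrite -(subnSK lt_kn) [qfac c (_ - _).+1]qfacS -(IHn _ lt_kn); ring.
  by rewrite qbin_small // (eqP (_ : n - k == 0)%N) ?subn_eq0 // subrr mulr0 mul0r.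
rewrite mulrDl -mulrA kE qfacS.
rewrite [qbin c n k * _](_ : _ =
  qbin c n k * (qfac c k * qfac c (n - k)) * (1 - c ^+ k.+1)); last by ring.
rewrite IHn // qfacS -(subnKC le_kn) addnC -addnS exprD addnK.
by rewrite ?addnS; ring.
Qed.

(* For [n >= 0] this is [a ^ (n(n+1)/2) b ^ (n(n-1)/2)]. *)
Definition theta_term (a b : fps) (n : int) : fps :=
  match n with
  | Posz n => a ^+ n * (a * b) ^+ 'C(n, 2)
  | Negz n => b ^+ n.+1 * (a * b) ^+ 'C(n.+1, 2)
  end.

Lemma theta_pos (a b : fps) n : theta_term a b (Posz n) = a ^+ n * (a * b) ^+ 'C(n, 2).
Proof. by []. Qed.

Lemma theta_neg (a b : fps) n :
  theta_term a b (Negz n) = b ^+ n.+1 * (a * b) ^+ 'C(n.+1, 2).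
Proof. by []. Qed.

Fixpoint zsum (B : nat) (f : int -> fps) : fps :=
  if B is B'.+1 then zsum B' f + f (Posz B) + f (Negz B') else f 0.

(* Ramanujan's theta function [f(a, b)], meaningful when [ab] has no constant
   term. *)
HB.lock Definition theta (a b : fps) : fps :=
  fun n => zsum n.+1 (theta_term a b) n.
Lemma thetaE a b n : theta a b n = zsum n.+1 (theta_term a b) n.
Proof. by rewrite theta.unlock. Qed.

Lemma zsumS B f :
  zsum B.+1 f = zsum B f + f (Posz B.+1) + f (Negz B).
Proof. by []. Qed.

Lemma eq_zsum B f g : (forall n, (`|n| <= B)%N -> f n = g n) ->
  zsum B f = zsum B g.
Proof.
elim: B => [|B IHB] fg /=; first exact: fg.
by rewrite IHB ?fg // => n nB; apply: fg; apply: leqW.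
Qed.

Lemma eqm_zsum k B f g : (forall n, (`|n| <= B)%N -> eqm k (f n) (g n)) ->
  eqm k (zsum B f) (zsum B g).
Proof.
elim: B => [|B IHB] fg /=; first exact: fg.
apply: eqmD (fg _ _) => //; apply: eqmD (fg _ _) => //.
by apply: IHB => n nB; apply: fg; apply: leqW.
Qed.

Lemma zsumZ B a f : zsum B (fun n => a * f n) = a * zsum B f.
Proof. by elim: B => //= B ->; ring. Qed.

(** The odd indices [2 n + 1] with [|n| <= B] stop at [- 2 B + 1] on the left, so [- 2 B - 1]
    remains as a boundary term; it disappears in the limit. *)
Lemma zsum2 B f : zsum B.*2.+1 f =
  zsum B (fun n => f (2 * n)) + zsum B (fun n => f (2 * n + 1)) +
  f (- (2 * B%:Z) - 1).
Proof.
elim: B => [|B IHB] //.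
rewrite doubleS [LHS]/= -/(zsum B.*2.+1 f) IHB /=.
have -> : 2 * B.+1%:Z = B.*2.+2 by lia.
have -> : 2 * Negz B = Negz B.*2.+1 by lia.
have -> : Posz B.*2.+2 + 1 = B.*2.+3 by lia.
have -> : Negz B.*2.+1 + 1 = - (2 * B%:Z) - 1 by lia.
have -> : - Posz B.*2.+2 - 1 = Negz B.*2.+2 by lia.
ring.
Qed.

Lemma zsum3 B f : zsum (3 * B).+1 f =
  zsum B (fun n => f (3 * n)) + zsum B (fun n => f (3 * n + 1)) +
  zsum B (fun n => f (3 * n - 1)).
Proof.
elim: B => [|B IHB]; first by rewrite /=; ring.
have -> : (3 * B.+1)%N = (3 * B).+3 by lia.
rewrite [LHS]/= -/(zsum (3 * B).+1 f) IHB /=.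
have -> : 3 * B.+1%:Z = (3 * B).+3 by lia.
have -> : 3 * Negz B = Negz (3 * B).+2 by lia.
have -> : Posz (3 * B).+3 + 1 = (3 * B).+4 by lia.
have -> : Posz (3 * B).+3 - 1 = (3 * B).+2 by lia.
have -> : Negz (3 * B).+2 + 1 = Negz (3 * B).+1 by lia.
have -> : Negz (3 * B).+2 - 1 = Negz (3 * B).+3 by lia.
ring.
Qed.

(** The term of index [n] is divisible by [(a b) ^ 'C(|n|, 2)], and the binomial is at least
    [|n| - 1]. *)
Lemma theta_term_vanish k (a b : fps) n : (a * b : fps) 0 = 0 -> (k < `|n|)%N ->
  eqm k (theta_term a b n) 0.
Proof.
move=> ab0; have aux c m : (k < m)%N -> eqm k (c * (a * b) ^+ 'C(m, 2)) 0.
  move=> km; rewrite -(mulr0 c); apply: eqmM (@eqm_refl k c) _.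
  apply: (eqmW _ (eqmX0 ab0)); case: m km => // m; rewrite ltnS => km.
  by rewrite binS bin1 (leq_trans km) // leq_addl.
by case: n => n; apply: aux.
Qed.

Lemma thetaP (a b : fps) n B : (a * b : fps) 0 = 0 -> (n <= B)%N ->
  eqm n (theta a b) (zsum B (theta_term a b)).
Proof.
move=> ab0 nB i lt_in; have : (i < B)%N by apply: leq_trans nB.
elim: B {nB} => // B IHB; rewrite ltnS leq_eqVlt.
move=> /predU1P[->|lt_iB]; first by rewrite thetaE.
have van m : (i.+1 < `|m|)%N -> theta_term a b m i = 0.
  by move=> im; apply: (theta_term_vanish ab0 im).
rewrite zsumS !fcoefD -IHB //.
by rewrite !van ?addr0 //= ltnS.
Qed.

Lemma thetaC (a b : fps) : theta a b = theta b a.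
Proof.
apply: fpsP => n; rewrite !thetaE; congr (_ n); elim: n.+1 => /= [|k ->].
  by rewrite !mul1r.
by rewrite (mulrC b) addrAC.
Qed.

Lemma rmorph_theta (h : {rmorphism fps -> fps}) (a b : fps) :
  (forall n f f', eqm n f f' -> eqm n (h f) (h f')) ->
  (a * b : fps) 0 = 0 -> (h a * h b : fps) 0 = 0 -> h (theta a b) = theta (h a) (h b).
Proof.
move=> hP ab0 hab0; apply: eqmP => n.
apply: eqm_trans (hP _ _ _ (thetaP ab0 (leqnn n))) _.
apply: eqm_sym; apply: eqm_trans (thetaP hab0 (leqnn n)) _ => i _.
congr (_ i); elim: n => [|n IHn] /=.
  by rewrite !expr0 mulr1 rmorph1.
by rewrite IHn !rmorphD /= !(rmorphM, rmorphXn).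
Qed.

Lemma bin2_2n n : 'C(2 * n, 2) = (4 * 'C(n, 2) + n)%N.
Proof. by elim: n => // n IHn; rewrite mulnS !addSn add0n !binS IHn !bin1 ?bin0; lia. Qed.

Lemma bin2_3n n : 'C(3 * n, 2) = (9 * 'C(n, 2) + 3 * n)%N.
Proof. by elim: n => // n IHn; rewrite mulnS !addSn add0n !binS IHn !bin1 ?bin0; lia. Qed.

Lemma bin2D m n : 'C(m + n, 2) = ('C(m, 2) + 'C(n, 2) + m * n)%N.
Proof. by elim: m => [|m IHm]; rewrite ?addn0 // addSn !binS IHm !bin1; lia. Qed.

Lemma eqm_eq n (f g : fps) : f = g -> eqm n f g.
Proof. by move=> ->. Qed.

Lemma exprMC (x : fps) m n : x ^+ (m * n) = (x ^+ n) ^+ m.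
Proof. by rewrite mulnC exprM. Qed.

Definition expr_norm := (exprMn, =^~ exprM).

Lemma bin2_sq n : (2 * 'C(n, 2) + n = n * n)%N.
Proof. by elim: n => // n IHn; rewrite binS bin1; lia. Qed.

(** Even and odd summation indices are separated. The series [h] plays the part of [b / a], which
    need not exist in the ring. *)
Lemma theta_dissect2 (a b h : fps) : b = a * h -> (a * b : fps) 0 = 0 ->
  theta a b = theta (a ^+ 3 * b) (a * b ^+ 3) + a * theta (a ^+ 5 * b ^+ 3) h.
Proof.
move=> bE ab0; apply: eqmP => n.
have abX0 m : ((a * b) ^+ m.+1 : fps) 0 = 0 by rewrite fcoefX0 ab0 exprS mul0r.
have c4 : a ^+ 3 * b * (a * b ^+ 3) = (a * b) ^+ 4 by ring.
have c4h : a ^+ 5 * b ^+ 3 * h = (a * b) ^+ 4 by rewrite bE; ring.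
have nB : (n <= n.*2.+1)%N by lia.
apply: eqm_trans (thetaP ab0 nB) _; rewrite zsum2 -[X in eqm n _ X]addr0.
apply: eqmD; last first.
  have -> : - (2 * n%:Z) - 1 = Negz n.*2 by lia.
  by apply: theta_term_vanish => //=; lia.
apply: eqmD; apply: eqm_sym.
  apply: eqm_trans (thetaP _ (leqnn n)) _; first by rewrite c4.
  apply: eqm_zsum => -[k|k] _; apply: eqm_eq.
    have -> : 2 * Posz k = Posz (2 * k) by [].
    rewrite !theta_pos c4 bin2_2n exprD !expr_norm !exprMC; ring.
  have -> : 2 * Negz k = Negz (2 * k).+1 by lia.
  rewrite !theta_neg c4 (_ : (2 * k).+2 = 2 * k.+1)%N; last by lia.
  rewrite bin2_2n exprD !expr_norm !exprMC; ring.
apply: eqm_trans (eqmM (@eqm_refl n a) (thetaP _ (leqnn n))) _; first by rewrite c4h.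
rewrite -zsumZ.
apply: eqm_zsum => -[k|k] _; apply: eqm_eq.
  have -> : 2 * Posz k + 1 = Posz (2 * k).+1 by lia.
  rewrite !theta_pos c4h binS bin1 bin2_2n bE -(addn1 (2 * k)).
  rewrite !exprD !expr_norm !exprMC; ring.
have -> : 2 * Negz k + 1 = Negz (2 * k) by lia.
rewrite !theta_neg c4h !binS !bin1 bin2_2n bE -(addn1 (2 * k)) -(addn1 k).
rewrite !exprD !expr_norm !exprMC; ring.
Qed.

(** The three terms collect the summation indices [3 n], [3 n + 1] and [3 n - 1]. *)
Lemma theta_dissect3 (a b : fps) : (a * b : fps) 0 = 0 ->
  theta a b = theta (a ^+ 6 * b ^+ 3) (a ^+ 3 * b ^+ 6) +
    a * theta (a ^+ 9 * b ^+ 6) (b ^+ 3) + b * theta (a ^+ 3) (a ^+ 6 * b ^+ 9).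
Proof.
move=> ab0; apply: eqmP => n.
have nB : (n <= (3 * n).+1)%N by lia.
have c0 : ((a * b) ^+ 9 : fps) 0 = 0 by rewrite fcoefX0 ab0.
have c1 : a ^+ 6 * b ^+ 3 * (a ^+ 3 * b ^+ 6) = (a * b) ^+ 9 by ring.
have c2 : a ^+ 9 * b ^+ 6 * b ^+ 3 = (a * b) ^+ 9 by ring.
have c3 : a ^+ 3 * (a ^+ 6 * b ^+ 9) = (a * b) ^+ 9 by ring.
have sumE (c a' b' : fps) f : a' * b' = (a * b) ^+ 9 ->
    (forall k, f k = c * theta_term a' b' k) ->
  eqm n (zsum n f) (c * theta a' b').
  move=> cE fE; apply: eqm_sym.
  apply: eqm_trans (eqmM (@eqm_refl n c) (thetaP _ (leqnn n))) _; first by rewrite cE.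
  by rewrite -zsumZ; apply: eqm_zsum => k _; apply: eqm_eq.
apply: eqm_trans (thetaP ab0 nB) _; rewrite zsum3.
apply: eqmD; first (apply: eqmD; first rewrite -[theta (_ * _) _]mul1r);
  apply: sumE => // -[k|k].
- have -> : 3 * Posz k = Posz (3 * k) by [].
  rewrite !theta_pos c1 bin2_3n !exprD !expr_norm !exprMC; ring.
- have -> : 3 * Negz k = Negz (3 * k).+2 by lia.
  rewrite !theta_neg c1 (_ : (3 * k).+3 = 3 * k.+1)%N; last by lia.
  rewrite bin2_3n !exprD !expr_norm !exprMC; ring.
- have -> : 3 * Posz k + 1 = Posz (3 * k).+1 by lia.
  rewrite !theta_pos c2 !binS !bin1 bin2_3n -(addn1 (3 * k)).
  rewrite !exprD !expr_norm !exprMC; ring.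
- have -> : 3 * Negz k + 1 = Negz (3 * k).+1 by lia.
  rewrite !theta_neg c2 !binS !bin1 !bin0 bin2_3n -(addn1 k) -(addn2 (3 * k)).
  rewrite !exprD !expr_norm !exprMC; ring.
(* The index [3 * 0 - 1] is already negative, so [k = 0] falls under the other branch of
   [theta_term]. *)
- case: k => [|k]; first by rewrite /= !mul1r !mulr1.
  have -> : 3 * Posz k.+1 - 1 = Posz (3 * k).+2 by lia.
  rewrite !theta_pos c3 !binS !bin1 !bin0 bin2_3n -(addn1 k) -(addn2 (3 * k)).
  rewrite !exprD !expr_norm !exprMC; ring.
- have -> : 3 * Negz k - 1 = Negz (3 * k).+3 by lia.
  rewrite !theta_neg c3 (_ : (3 * k).+4 = (3 * k.+1).+1)%N; last by lia.
  rewrite binS bin1 bin2_3n -(addn1 (3 * _)).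
  rewrite !exprD !expr_norm !exprMC; ring.
Qed.

Lemma sum_zsum (G : nat -> fps) n :
  \sum_(k < (2 * n).+1) G k = zsum n (fun i => G (absz (n%:Z + i))).
Proof.
have aux B : (B <= n)%N ->
    zsum B (fun i => G (absz (n%:Z + i))) = \sum_(n - B <= k < (n + B).+1) G k.
  elim: B => [_|B IHB Bn]; first by rewrite subn0 addn0 big_nat1 /= addn0.
  rewrite zsumS IHB; last exact: ltnW.
  rewrite (_ : absz (n%:Z + Posz B.+1) = (n + B.+1)%N); last by lia.
  rewrite (_ : absz (n%:Z + Negz B) = (n - B.+1)%N); last by lia.
  rewrite [RHS]big_nat_recr /=; last by lia.
  rewrite [in RHS]big_ltn; last by lia.
  by rewrite subnSK // addnS; ring.
by rewrite aux // subnn addnn -mul2n big_mkord.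
Qed.

(* Taking [x = (ab) ^ n] and [y = a] in the q-binomial theorem makes the product
   symmetric in [a] and [b]. *)
Lemma finite_triple_product (a b : fps) n : a != 0 -> b != 0 ->
  \prod_(i < n) (1 + a * (a * b) ^+ i) * \prod_(i < n) (1 + b * (a * b) ^+ i) =
  zsum n (fun k => qbin (a * b) (2 * n) (absz (n%:Z + k)) * theta_term a b k).
Proof.
move=> a0 b0; set c := a * b.
(* In the product of [c ^ n + a c ^ i] over [i < 2 n], the first half gives [a ^ n c ^ 'C(n, 2)]
   times the product with [b], and the second half gives [c ^ (n * n)] times the one with [a]; [K]
   is the total factor. *)
pose K := a ^+ n * c ^+ ('C(n, 2) + n * n).
have K0 : K != 0 by rewrite mulf_neq0 ?expf_neq0 ?mulf_neq0.
apply: (mulfI K0).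
have step1 : \prod_(i < n) (c ^+ n + a * c ^+ i) =
    a ^+ n * c ^+ 'C(n, 2) * \prod_(i < n) (1 + b * c ^+ i).
  have -> : a ^+ n * c ^+ 'C(n, 2) = \prod_(i < n) (a * c ^+ i).
    elim: (n) => [|m IHm]; first by rewrite big_ord0 mulr1.
    by rewrite big_ord_recr /= -IHm exprS binS bin1 exprD; ring.
  rewrite [X in _ * X](reindex_inj rev_ord_inj) -big_split /=.
  apply: eq_bigr => i _.
  have -> : c ^+ n = c * c ^+ i * c ^+ (n - i.+1).
    by rewrite -exprS -exprD subnKC.
  by rewrite /c; ring.
have step2 : \prod_(i < n) (c ^+ n + a * c ^+ (n + i)) =
    c ^+ (n * n) * \prod_(i < n) (1 + a * c ^+ i).
  have -> : c ^+ (n * n) = \prod_(i < n) c ^+ n.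
    by rewrite prodr_const card_ord exprM.
  rewrite -big_split /=.
  by apply: eq_bigr => i _; rewrite exprD; ring.
transitivity (\prod_(i < 2 * n) (c ^+ n + a * c ^+ i)).
  by rewrite mul2n -addnn big_split_ord /= step1 step2 /K exprD; ring.
rewrite qbin_qpow (sum_zsum (fun k =>
  qbin c (2 * n) k * c ^+ 'C(k, 2) * (c ^+ n) ^+ (2 * n - k) * a ^+ k)) -zsumZ.
apply: eq_zsum => -[k|k] kn.
  have {}kn : (k <= n)%N by [].
  rewrite (_ : absz (n%:Z + Posz k) = (n + k)%N); last by lia.
  rewrite theta_pos -/c bin2D (_ : 2 * n - (n + k) = n - k)%N; last by lia.
  have cE : c ^+ 'C(n + k, 2) * c ^+ n ^+ (n - k) =
      c ^+ ('C(n, 2) + n * n) * c ^+ 'C(k, 2).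
    rewrite -exprM -!exprD; congr (_ ^+ _).
    by rewrite bin2D mulnBr; have := leq_mul (leqnn n) kn; lia.
  rewrite bin2D in cE *.
  transitivity (qbin c (2 * n) (n + k) * (c ^+ ('C(n, 2) + 'C(k, 2) + n * k) *
    c ^+ n ^+ (n - k)) * a ^+ (n + k)); first by rewrite !mulrA.
  rewrite cE [a ^+ (_ + _)]exprD /K; move: (c ^+ (_ + _)) (c ^+ 'C(k, 2)) (qbin _ _ _) => C1 C2 Q.
  by ring.
have {}kn : (k < n)%N by [].
rewrite (_ : absz (n%:Z + Negz k) = (n - k.+1)%N); last by lia.
rewrite theta_neg -/c (_ : 2 * n - (n - k.+1) = n + k.+1)%N; last by lia.
have cE : c ^+ 'C(n - k.+1, 2) * c ^+ n ^+ (n + k.+1) =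
    c ^+ ('C(n, 2) + n * n) * c ^+ k.+1 * c ^+ 'C(k.+1, 2).
  rewrite -exprM -!exprD; congr (_ ^+ _).
  have -> : 'C(n, 2) = ('C(n - k.+1, 2) + 'C(k.+1, 2) + (n - k.+1) * k.+1)%N.
    by rewrite -bin2D subnK.
  rewrite mulnDr mulnBl.
  by have := leq_mul kn (leqnn k.+1); have := bin2_sq k.+1; lia.
transitivity (qbin c (2 * n) (n - k.+1) * (c ^+ 'C(n - k.+1, 2) *
  c ^+ n ^+ (n + k.+1)) * a ^+ (n - k.+1)); first by rewrite !mulrA.
have aE : a ^+ n = a ^+ (n - k.+1) * a ^+ k.+1 by rewrite -exprD subnK.
rewrite cE /K aE (_ : c ^+ k.+1 = a ^+ k.+1 * b ^+ k.+1); last exact: exprMn.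
move: (c ^+ (_ + _)) (c ^+ 'C(_, 2)) (qbin _ _ _) (a ^+ (n - _)) => C1 C2 Q A.
by ring.
Qed.

(** Jacobi's triple product, as the limit of the finite version: modulo [q ^ n] the binomials near
    the centre are the inverse of [poch c c], and the terms far from it vanish. *)
Lemma triple_product (a b : fps) : a != 0 -> b != 0 -> (a * b : fps) 0 = 0 ->
  theta a b = poch (- a) (a * b) * poch (- b) (a * b) * poch (a * b) (a * b).
Proof.
move=> a0 b0; set c := a * b => c0; apply: eqmP => n.
(* With this [M], both [M + k] and [M - k] are at least [n] whenever [|k| <= n]. *)
pose M := n.*2.+1; have nM : (n <= M)%N by rewrite /M; lia.
have facE k : (n <= k)%N -> eqm n (qfac c k) (poch c c).
  by move=> nk; apply/eqm_sym/(eqmW nk)/pochP.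
apply: eqm_trans (thetaP c0 nM) _; apply: eqm_sym.
have pE d : eqm n (poch (- d) c) (\prod_(i < M) (1 + d * c ^+ i)).
  apply: eqm_trans (eqmW nM (pochP _ c0)) _; apply: eqm_eq.
  by apply: eq_bigr => i _; rewrite mulNr opprK.
apply: eqm_trans (eqmM (eqmM (pE a) (pE b)) (@eqm_refl n _)) _.
rewrite finite_triple_product // mulrC -zsumZ; apply: eqm_zsum => k kM.
have [nk|kn] := ltnP n `|k|.
  have van := theta_term_vanish c0 nk.
  apply: eqm_trans (eqmM (@eqm_refl n _) (eqmM (@eqm_refl n _) van)) _.
  by rewrite !mulr0; apply: eqm_sym.
rewrite mulrA -[X in eqm n _ X]mul1r; apply: eqmM => //.
set m := absz _; have [mM nm] : (m <= 2 * M)%N /\ (n <= m)%N by rewrite /m /M; lia.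
have nm' : (n <= 2 * M - m)%N by rewrite /m /M; lia.
apply: (@eqm_cancel _ _ _ (poch c c)); first exact: poch0.
rewrite mul1r (_ : _ * _ * _ = qbin c (2 * M) m * (poch c c * poch c c)); last by ring.
have nM2 : (n <= 2 * M)%N by lia.
apply: eqm_trans _ (facE _ nM2); rewrite -(qbin_fac c mM).
by apply: eqmM => //; apply: eqmM; apply: eqm_sym; apply: facE.
Qed.

Lemma q0 : q 0 = 0. Proof. by rewrite coef_q. Qed.
Lemma qX0 k : (0 < k)%N -> (q ^+ k) 0 = 0.
Proof. by case: k => // k _; rewrite fcoefX0 exprS q0 mul0r. Qed.

(** * Eta quotients *)

HB.lock Definition euler k : fps := poch (q ^+ k) (q ^+ k).
Lemma eulerE k : euler k = poch (q ^+ k) (q ^+ k).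
Proof. by rewrite euler.unlock. Qed.

Lemma euler0 k : (0 < k)%N -> euler k 0 = 1.
Proof. by move=> k0; rewrite eulerE poch0 ?qX0. Qed.

Lemma fps_neq0 (f : fps) : f 0 = 1 -> f != 0.
Proof. by move=> f0; apply/eqP => /(congr1 (fun g : fps => g 0)); rewrite f0. Qed.

Lemma V_qX m k : (0 < m)%N -> V m (q ^+ k) = q ^+ (m * k).
Proof. by move=> m0; rewrite rmorphXn /= Vq // -exprM. Qed.

Lemma V_euler m k : (0 < m)%N -> (0 < k)%N -> V m (euler k) = euler (m * k).
Proof. by move=> m0 k0; rewrite !eulerE V_poch ?V_qX // qX0. Qed.

Lemma N_qX k : N (q ^+ k) = (-1) ^+ k * q ^+ k.
Proof. by rewrite rmorphXn /= Nq [LHS]exprNn. Qed.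

Lemma poch_shift (a c : fps) : c 0 = 0 -> poch a c = (1 - a) * poch (a * c) c.
Proof.
move=> c0; apply: eqmP => n.
have nn : (n <= n.+1)%N by [].
apply: eqm_trans (eqmW nn (pochP a c0)) _.
apply: eqm_sym; apply: eqm_trans (eqmM (@eqm_refl n _) (pochP (a * c) c0)) _.
rewrite big_ord_recl mulr1; apply: eqm_eq; congr (_ * _).
by apply: eq_bigr => i _; rewrite exprS mulrA.
Qed.

Lemma euler_split m k : (0 < m)%N -> (0 < k)%N ->
  euler k = \prod_(r < m) poch (q ^+ (k * r.+1)) (q ^+ (m * k)).
Proof.
move=> m0 k0; rewrite eulerE (poch_split _ m0) ?qX0 //.
by apply: eq_bigr => r _; rewrite -!exprM -exprD mulnS (mulnC m).
Qed.

Lemma poch_neg1 : poch (- q) q * euler 1 = euler 2.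
Proof. by rewrite mulrC !eulerE !expr1 pochMN ?q0. Qed.

(** Changing the sign of [q] affects only the odd factors of [f1], and
    $(q;q^2)_\infty(-q;q^2)_\infty = (q^2;q^4)_\infty = f_2/f_4$. *)
Lemma N_euler1 : euler 1 * N (euler 1) * euler 4 = euler 2 ^+ 3.
Proof.
have e1 : euler 1 = poch q (q ^+ 2) * euler 2.
  by rewrite (@euler_split 2) // eulerE !big_ord_recl big_ord0 mulr1.
have e2 : euler 2 = poch (q ^+ 2) (q ^+ 4) * euler 4.
  by rewrite (@euler_split 2) // eulerE !big_ord_recl big_ord0 mulr1.
have nq2 k : ~~ odd k -> N (q ^+ k) = q ^+ k.
  by move=> /negPf k2; rewrite N_qX -signr_odd k2 mul1r.
have -> : N (euler 1) = poch (- q) (q ^+ 2) * euler 2.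
  by rewrite e1 rmorphM /= eulerE !N_poch ?qX0 // Nq !nq2.
rewrite {1}e1 (_ : _ * _ * _ = poch q (q ^+ 2) * poch (- q) (q ^+ 2) *
  euler 4 * euler 2 ^+ 2); last by ring.
by rewrite pochMN ?qX0 // -exprM -e2; ring.
Qed.

Lemma N_eulerE k : odd k ->
  N (euler k) = euler (2 * k) ^+ 3 / (euler k * euler (4 * k)).
Proof.
move=> k1; have k0 := odd_gt0 k1.
have U : euler k * euler (4 * k) \is a GRing.unit.
  by apply: unit_fps1; rewrite fcoefM0 !euler0 // muln_gt0 k0.
apply: (canRL (mulrK U)); have := congr1 (V k) N_euler1.
rewrite rmorphXn !rmorphM /= !V_euler // -NV_odd // V_euler // muln1.
by rewrite (mulnC k 2) (mulnC k 4) => <-; ring.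
Qed.

Lemma N_euler_even k : (0 < k)%N -> ~~ odd k -> N (euler k) = euler k.
Proof.
move=> k0 k2; rewrite -{1}[k]muln1 -V_euler // NV_even //.
by rewrite V_euler // muln1.
Qed.

Lemma qXD0 i j : (0 < i + j)%N -> (- q ^+ i * - q ^+ j : fps) 0 = 0.
Proof. by move=> ij; rewrite mulrNN -exprD qX0. Qed.

Lemma qX_neq0 k : q ^+ k != 0. Proof. by rewrite expf_neq0 ?q_neq0. Qed.

Lemma thetaNN i j : (0 < i + j)%N -> theta (- q ^+ i) (- q ^+ j) =
  poch (q ^+ i) (q ^+ (i + j)) * poch (q ^+ j) (q ^+ (i + j)) * euler (i + j).
Proof.
move=> ij; rewrite triple_product ?oppr_eq0 ?qX_neq0 ?qXD0 //.
by rewrite mulrNN -exprD !opprK eulerE.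
Qed.

(** Euler's pentagonal number theorem: the three products are the residue classes modulo 3 in
    [f1]. *)
Lemma theta_f1 : theta (- q ^+ 1) (- q ^+ 2) = euler 1.
Proof.
by rewrite thetaNN // [RHS](@euler_split 3) // eulerE !big_ord_recl big_ord0 mulr1 mulrA.
Qed.

(* Keeping the field abstract lets [field] work without unfolding fractions. *)
Lemma fps_embeds : exists (K : fieldType) (i : {rmorphism fps -> K}), injective i.
Proof.
exists {fraction fps}, (@FracField.tofrac fps).
by move=> f g /eqP; rewrite tofrac_eq => /eqP.
Qed.

Section Embedding.
Variables (K : fieldType) (i : {rmorphism fps -> K}).

Lemma rmorph_unitV (f : fps) : f 0 = 1 -> i f^-1 = (i f)^-1.
Proof. by move=> f0; rewrite rmorphV // unit_fps1. Qed.

Lemma rmorph_neq0 (f : fps) : injective i -> f 0 = 1 -> i f != 0.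
Proof. by move=> inj f0; rewrite -(rmorph0 i) (inj_eq inj) fps_neq0. Qed.
End Embedding.

Notation f1 := (euler 1).
Notation f2 := (euler 2).
Notation f3 := (euler 3).
Notation f4 := (euler 4).
Notation f6 := (euler 6).
Notation f8 := (euler 8).
Notation f9 := (euler 9).
Notation f12 := (euler 12).
Notation f18 := (euler 18).
Notation f24 := (euler 24).
Notation f36 := (euler 36).

(* Ramanujan's [f(-q,-q^11)] and [f(-q^5,-q^7)]: [X = thX / f1] and
   [Y = thY / f1]. *)
HB.lock Definition thX := theta (- q ^+ 1) (- q ^+ 11).
HB.lock Definition thY := theta (- q ^+ 5) (- q ^+ 7).

Lemma thXE : thX = poch q (q ^+ 12) * poch (q ^+ 11) (q ^+ 12) * f12.
Proof. by rewrite thX.unlock thetaNN. Qed.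
Lemma thYE : thY = poch (q ^+ 5) (q ^+ 12) * poch (q ^+ 7) (q ^+ 12) * f12.
Proof. by rewrite thY.unlock thetaNN. Qed.

Lemma thX0 : thX 0 = 1.
Proof. by rewrite thXE !fcoefM0 euler0 // !poch0 ?qX0 ?q0. Qed.
Lemma thY0 : thY 0 = 1.
Proof. by rewrite thYE !fcoefM0 euler0 // !poch0 ?qX0 ?q0. Qed.

Definition const1E := (fcoefM0, fcoefX0, euler0, thX0, thY0, fcoefV0, V0, N0, mulr1, expr1n).
Ltac const1 := by rewrite ?const1E //; do ?[rewrite fcoefV0]; rewrite ?const1E.

(** Maps an identity into the abstract field, where the series with constant term 1 become nonzero
    atoms. The rounds are repeated because moving the morphism inside an inverse exposes new
    products. *)
Ltac to_field i inj :=
  apply: (inj); do 3 (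
    rewrite ?(rmorph_nat, rmorphXn, rmorphM, rmorphD, rmorphB, rmorphN, rmorph1) /=;
    rewrite ?rmorph_unitV; [|by const1..]);
  have := rmorph_neq0 inj (@euler0 1 isT); have := rmorph_neq0 inj (@euler0 2 isT);
  have := rmorph_neq0 inj (@euler0 3 isT); have := rmorph_neq0 inj (@euler0 4 isT);
  have := rmorph_neq0 inj (@euler0 6 isT); have := rmorph_neq0 inj (@euler0 8 isT);
  have := rmorph_neq0 inj (@euler0 9 isT); have := rmorph_neq0 inj (@euler0 12 isT);
  have := rmorph_neq0 inj (@euler0 18 isT); have := rmorph_neq0 inj (@euler0 24 isT);
  have := rmorph_neq0 inj (@euler0 36 isT);
  have := rmorph_neq0 inj thX0; have := rmorph_neq0 inj thY0;
  move: (i f1) (i f2) (i f3) (i f4) (i f6) (i f8) (i f9) (i f12) (i f18)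
    (i f24) (i f36) (i thX) (i thY) (i q) => ? ? ? ? ? ? ? ? ? ? ? ? ? ? ? ? ? ? ? ? ? ? ? ? ? ? ?.
Ltac fps_field :=
  let K := fresh in let i := fresh in let inj := fresh in
  have [K [i inj]] := fps_embeds; to_field i inj; field;
  repeat (apply/andP; split); done.

(** * Theta functions that are eta quotients *)

Lemma divr_eqP (a b c : fps) : b 0 = 1 -> a * b = c -> a = c / b.
Proof. by move=> /unit_fps1 bU <-; rewrite mulrK. Qed.

(** The two products are $(-q;q)_\infty = f_2/f_1$ without the multiples of 3, whose share is
    $f_6/f_3$. *)
Lemma theta_P : theta q (q ^+ 2) = f2 * f3 ^+ 2 / (f1 * f6).
Proof.
rewrite triple_product ?q_neq0 ?qX_neq0 -?exprS ?qX0 //.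
have e3 : poch (- q) (q ^+ 3) * poch (- q ^+ 2) (q ^+ 3) * poch (- q ^+ 3) (q ^+ 3) =
    poch (- q) q.
  rewrite [RHS](@poch_split 3) ?q0 // !big_ord_recl big_ord0 !mulr1 mulrA.
  by rewrite !mulNr -expr2 -exprS.
have := poch_neg1; rewrite -e3 => e3f1; have := congr1 (V 3) poch_neg1.
rewrite rmorphM /= V_poch ?q0 // rmorphN /= Vq // !V_euler // !muln1 !(muln2, mulnC 3 2) => f6E.
apply: divr_eqP; first by const1.
rewrite -e3f1 -f6E; rewrite (eulerE 3); ring.
Qed.

(** This is $2\psi(q)$; the 2 is the factor [j = 0] of [poch (- 1) q]. *)
Lemma theta_psi : theta 1 q = 2 * (f2 ^+ 2 / f1).
Proof.
rewrite triple_product ?oner_eq0 ?q_neq0 ?mul1r ?q0 //.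
rewrite poch_shift ?q0 // mulN1r opprK.
have -> : poch (- q) q = f2 / f1 by apply: divr_eqP poch_neg1; const1.
have -> : poch q q = f1 by rewrite eulerE expr1.
fps_field.
Qed.

(** This is $\varphi(-q)$. *)
Lemma theta_phiN : theta (- q) (- q) = f1 ^+ 2 / f2.
Proof.
rewrite -[q]expr1 thetaNN //.
have -> : f1 = poch (q ^+ 1) (q ^+ 2) * f2.
  by rewrite (@euler_split 2) // eulerE !big_ord_recl big_ord0 mulr1.
apply: divr_eqP; first by const1.
by ring.
Qed.

Lemma euler_mod6 : exists a b c d : fps,
 [/\ f1 = poch (q ^+ 1) (q ^+ 6) * a * b * c * poch (q ^+ 5) (q ^+ 6) * f6,
     f2 = a * c * f6 & f3 = b * f6].
Proof.
exists (poch (q ^+ 2) (q ^+ 6)), (poch (q ^+ 3) (q ^+ 6)), (poch (q ^+ 4) (q ^+ 6)), 1.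
split.
- by rewrite (@euler_split 6) // eulerE !big_ord_recl big_ord0 mulr1 ?mulrA.
- by rewrite (@euler_split 3) // eulerE !big_ord_recl big_ord0 mulr1 ?mulrA.
- by rewrite (@euler_split 2) // eulerE !big_ord_recl big_ord0 mulr1 ?mulrA.
Qed.

Lemma theta_b : theta (- q) (- q ^+ 5) = f1 * f6 ^+ 2 / (f2 * f3).
Proof.
rewrite -[q in theta (- q)]expr1 thetaNN //; apply: divr_eqP; first by const1.
by have [a [b [c [_ [-> -> ->]]]]] := euler_mod6; ring.
Qed.

(** The residues 1, 5, 7, 11 modulo 12 are the residues 1 and 5 modulo 6, so the product reduces to
    $f(-q,-q^5)$. *)
Lemma thX_thYE : thX * thY = f1 * f6 * f12 ^+ 2 / (f2 * f3).
Proof.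
have e6 : poch q (q ^+ 6) * poch (q ^+ 5) (q ^+ 6) * f12 ^+ 2 = thX * thY.
  rewrite thXE thYE (@poch_split 2 q) ?qX0 // (@poch_split 2 (q ^+ 5)) ?qX0 //.
  rewrite !big_ord_recl !big_ord0 !expr0 !expr1 -!exprM -exprS -exprD !mulr1.
  by rewrite /bump /=; ring.
apply: divr_eqP; first by const1.
have bE : poch q (q ^+ 6) * poch (q ^+ 5) (q ^+ 6) * f6 = f1 * f6 ^+ 2 / (f2 * f3).
  by rewrite -theta_b -[q in theta (- q)]expr1 thetaNN // expr1.
have U : f6 \is a GRing.unit by apply: unit_fps1; const1.
apply: (mulIr U); transitivity (poch q (q ^+ 6) * poch (q ^+ 5) (q ^+ 6) * f6 *
  f12 ^+ 2 * (f2 * f3)); first by rewrite -e6; ring.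
rewrite bE; fps_field.
Qed.

Lemma V_theta m (a b : fps) : (0 < m)%N -> (a * b : fps) 0 = 0 ->
  V m (theta a b) = theta (V m a) (V m b).
Proof.
move=> m0 ab0; apply: rmorph_theta => //; first exact: V_eqm.
by rewrite -rmorphM /= V0.
Qed.

Lemma N_theta (a b : fps) : (a * b : fps) 0 = 0 ->
  N (theta a b) = theta (N a) (N b).
Proof.
move=> ab0; apply: rmorph_theta => //; first exact: N_eqm.
by rewrite -rmorphM /= N0.
Qed.

Lemma N_qX_odd k : odd k -> N (q ^+ k) = - q ^+ k.
Proof. by move=> k1; rewrite N_qX -signr_odd k1 mulN1r. Qed.

Lemma N_thX : N thX = theta (q ^+ 11) q.
Proof.
rewrite thX.unlock N_theta ?qXD0 // !rmorphN /= !N_qX_odd //.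
by rewrite !opprK thetaC expr1.
Qed.
Lemma N_thY : N thY = theta (q ^+ 5) (q ^+ 7).
Proof.
rewrite thY.unlock N_theta ?qXD0 // !rmorphN /= !N_qX_odd //.
by rewrite !opprK.
Qed.

(** The summation index is split by parity, with [b / a = q]. After [q -> -q] this evaluates
    [thY - q * thX]; the same splitting of [f1] evaluates [thY + q * thX]. *)
Lemma P_dissect : theta q (q ^+ 2) = N thY + q * N thX.
Proof.
rewrite (@theta_dissect2 q (q ^+ 2) q) ?fcoefM0 ?q0 ?mul0r // N_thX N_thY.
by congr (theta _ _ + _ * theta _ _); ring.
Qed.

Lemma f1_dissect : f1 = N thY - q * N thX.
Proof.
rewrite -theta_f1 (@theta_dissect2 _ _ q) ?qXD0 //; last by ring.
rewrite N_thX N_thY expr1 -[- (q * theta _ _)]mulNr.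
by congr (theta _ _ + _ * theta _ _); ring.
Qed.

Lemma N_f1 : N f1 = f2 ^+ 3 / (f1 * f4). Proof. exact: (@N_eulerE 1). Qed.
Lemma N_f3 : N f3 = f6 ^+ 3 / (f3 * f12). Proof. exact: (@N_eulerE 3). Qed.

Lemma NV1 (f : fps) : f 0 = 1 -> N f^-1 = (N f)^-1.
Proof. by move=> f0; rewrite rmorphV // unit_fps1. Qed.
Lemma VV1 m (f : fps) : f 0 = 1 -> V m f^-1 = (V m f)^-1.
Proof. by move=> f0; rewrite rmorphV // unit_fps1. Qed.

Ltac push := rewrite ?(rmorph_nat, rmorphXn, rmorphM, rmorphD, rmorphB, rmorphN, rmorph1) /=.

(** * The series s = 1/H + H - 1 *)

(* [F = Y / X = q / H]; with [s = 1 / H + H - 1] one has [S = q s] and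
   [d = q (1 / H - H)]. *)
HB.lock Definition F := thY / thX.
Lemma FE : F = thY / thX. Proof. by rewrite F.unlock. Qed.
Lemma F0 : F 0 = 1. Proof. by rewrite FE; const1. Qed.

HB.lock Definition S := F + q ^+ 2 / F - q.
HB.lock Definition d := F - q ^+ 2 / F.
Lemma SE : S = F + q ^+ 2 / F - q. Proof. by rewrite S.unlock. Qed.
Lemma dE : d = F - q ^+ 2 / F. Proof. by rewrite d.unlock. Qed.

Lemma thY_sub_qthX : thY - q * thX = f1 * f4 * f6 ^+ 5 / (f2 ^+ 2 * f3 ^+ 2 * f12 ^+ 2).
Proof.
have := congr1 N P_dissect; rewrite theta_P !(rmorphD, rmorphM) /= !NK Nq mulNr => <-.
rewrite NV1; last by const1.
push; rewrite N_f1 N_f3 !N_euler_even //; fps_field.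
Qed.

Lemma thY_add_qthX : thY + q * thX = f2 ^+ 3 / (f1 * f4).
Proof.
have := congr1 N f1_dissect; rewrite !(rmorphB, rmorphM) /= !NK Nq mulNr opprK => <-.
exact: N_f1.
Qed.

(** Over the denominator [thX * thY] the numerators of [S - q] and [S + 3 q] are perfect squares,
    and that of [d] is a difference of squares. *)
Lemma S_sub1 : S - q = f1 * f4 ^+ 2 * f6 ^+ 9 / (f2 ^+ 3 * f3 ^+ 3 * f12 ^+ 6).
Proof.
have -> : S - q = (thY - q * thX) ^+ 2 / (thX * thY) by rewrite SE FE; fps_field.
rewrite thY_sub_qthX thX_thYE; fps_field.
Qed.
Lemma S_add3 : S + 3 * q = f2 ^+ 7 * f3 / (f1 ^+ 3 * f4 ^+ 2 * f6 * f12 ^+ 2).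
Proof.
have -> : S + 3 * q = (thY + q * thX) ^+ 2 / (thX * thY) by rewrite SE FE; fps_field.
rewrite thY_add_qthX thX_thYE; fps_field.
Qed.
Lemma d_eta : d = f2 ^+ 2 * f6 ^+ 4 / (f1 * f3 * f12 ^+ 4).
Proof.
have -> : d = (thY + q * thX) * (thY - q * thX) / (thX * thY) by rewrite dE FE; fps_field.
rewrite thY_add_qthX thY_sub_qthX thX_thYE; fps_field.
Qed.

(** Here and in the next two lemmas [q -> -q] is applied to the known eta quotients; once [S] is
    known to be even, these evaluate [S + q] and [S - 3 q]. *)
Lemma NS_add1 : N S + q = f3 ^+ 3 * f4 / (f1 * f12 ^+ 3).
Proof.
have -> : N S + q = N (S - q) by push; rewrite Nq opprK.
rewrite S_sub1 rmorphM /= NV1; last by const1.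
push; rewrite N_f1 N_f3 !N_euler_even //; fps_field.
Qed.
Lemma NS_sub3 : N S - 3 * q = f1 ^+ 3 * f4 * f6 ^+ 2 / (f2 ^+ 2 * f3 * f12 ^+ 3).
Proof.
have -> : N S - 3 * q = N (S + 3 * q) by push; rewrite Nq mulrN.
rewrite S_add3 rmorphM /= NV1; last by const1.
push; rewrite N_f1 N_f3 !N_euler_even //; fps_field.
Qed.
Lemma Nd_eta : N d = f1 * f3 * f4 * f6 / (f2 * f12 ^+ 3).
Proof.
rewrite d_eta rmorphM /= NV1; last by const1.
push; rewrite N_f1 N_f3 !N_euler_even //; fps_field.
Qed.

Lemma V_pochq m i j : (0 < m)%N -> (0 < j)%N ->
  V m (poch (q ^+ i) (q ^+ j)) = poch (q ^+ (m * i)) (q ^+ (m * j)).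
Proof. by move=> m0 j0; rewrite V_poch ?qX0 // !V_qX. Qed.

Lemma mul_N_pochq i j : odd i -> (0 < j)%N -> ~~ odd j ->
  poch (q ^+ i) (q ^+ j) * N (poch (q ^+ i) (q ^+ j)) =
  V 2 (poch (q ^+ i) (q ^+ j)).
Proof.
move=> i1 j0 /negPf j2; rewrite V_pochq // N_poch ?qX0 // N_qX_odd //.
by rewrite N_qX -signr_odd j2 mul1r pochMN ?qX0 // -!exprM !(mulnC 2).
Qed.

Lemma mul_N_theta i j : odd i -> odd j -> let t := theta (- q ^+ i) (- q ^+ j) in
  V 2 t * euler (i + j) ^+ 2 = t * N t * euler (2 * (i + j)).
Proof.
move=> i1 j1 t; have ij0 : (0 < i + j)%N by rewrite addn_gt0 odd_gt0.
have ij2 : ~~ odd (i + j) by rewrite oddD i1 j1.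
have tE : t = poch (q ^+ i) (q ^+ (i + j)) * poch (q ^+ j) (q ^+ (i + j)) *
    euler (i + j) by exact: thetaNN.
have VtE : V 2 t = V 2 (poch (q ^+ i) (q ^+ (i + j))) *
    V 2 (poch (q ^+ j) (q ^+ (i + j))) * euler (2 * (i + j)).
  by rewrite tE !rmorphM /= V_euler.
have NtE : N t = N (poch (q ^+ i) (q ^+ (i + j))) *
    N (poch (q ^+ j) (q ^+ (i + j))) * euler (i + j).
  by rewrite tE !rmorphM /= N_euler_even.
rewrite VtE NtE tE -!mul_N_pochq //; ring.
Qed.

(** By [mul_N_theta], [thX] and [thY] satisfy this relation up to the same factor $f_{24}/f_{12}^2$,
    which cancels in the quotient. *)
Lemma V2F : V 2 F = F * N F.
Proof.
have xN : V 2 thX * f12 ^+ 2 = thX * N thX * f24 by rewrite thX.unlock; exact: mul_N_theta.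
have yN : V 2 thY * f12 ^+ 2 = thY * N thY * f24 by rewrite thY.unlock; exact: mul_N_theta.
have U : V 2 thX * f12 ^+ 2 \is a GRing.unit by apply: unit_fps1; const1.
apply: (mulIr U); rewrite FE !rmorphM /= VV1 ?NV1; try by const1.
have [K [i inj]] := fps_embeds.
have Vx0 : i (V 2 thX) != 0 by apply: rmorph_neq0 => //; const1.
have Nx0 : i (N thX) != 0 by apply: rmorph_neq0 => //; const1.
have h0 : i thX != 0 by apply: rmorph_neq0 => //; const1.
transitivity (thY * N thY * f24); first by rewrite -yN; apply: (inj); push;
  rewrite rmorph_unitV; [field | const1].
rewrite xN; apply: (inj); push; rewrite !rmorph_unitV; try by const1.
by field; rewrite Nx0.
Qed.

Lemma fcoef_nat0 n : (n%:R : fps) 0 = n%:Z.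
Proof. by rewrite fcoefMn -[RHS]natz. Qed.

Lemma fps_nat_neq0 n : (n.+1%:R : fps) != 0.
Proof. by apply/eqP => /(congr1 (fun f : fps => f 0)); rewrite fcoef_nat0. Qed.

Lemma S0 : S 0 = 1.
Proof. by rewrite SE fcoefB fcoefD q0 subr0 F0 fcoefM0 qX0 // mul0r addr0. Qed.
Lemma d0 : d 0 = 1.
Proof. by rewrite dE fcoefB F0 fcoefM0 qX0 // mul0r subr0. Qed.

Lemma NF_add : N S - q = N F + q ^+ 2 / N F.
Proof.
have -> : N S - q = N (S + q) by push; rewrite Nq.
rewrite SE subrK; push; rewrite Nq sqrrN NV1 //; exact: F0.
Qed.
Lemma NF_sub : N d = N F - q ^+ 2 / N F.
Proof. rewrite dE; push; rewrite Nq sqrrN NV1 //; exact: F0. Qed.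

(* This is [H(q^2) = - H(q) H(-q)] in terms of [S] and [d]. *)
Lemma V2S_mul : 2 * (V 2 S + q ^+ 2) = (S + q) * (N S - q) + d * N d.
Proof.
have VF1 : F * N F != 0 by apply: fps_neq0; rewrite fcoefM0 N0 F0.
have -> : V 2 S + q ^+ 2 = F * N F + q ^+ 4 / (F * N F).
  rewrite SE; push; rewrite VV1 ?F0 // V2F Vq //; ring.
rewrite NF_add NF_sub SE dE.
have [K [i inj]] := fps_embeds.
have F1 : i F != 0 by apply: rmorph_neq0 => //; exact: F0.
have NF1 : i (N F) != 0 by apply: rmorph_neq0 => //; rewrite N0 F0.
apply: (inj); push; rewrite !rmorph_unitV ?fcoefM0 ?N0 ?F0 //; push.
by field; rewrite ?NF1 ?F1.
Qed.

(** Both sides are [(S + q) ^ 2 - 4 q ^ 2]. *)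
Lemma d_sq : d ^+ 2 = (S - q) * (S + 3 * q).
Proof.
have [K [i inj]] := fps_embeds.
have F1 : i F != 0 by apply: rmorph_neq0 => //; exact: F0.
rewrite SE dE; apply: (inj); push; rewrite !rmorph_unitV ?F0 //; push.
by field.
Qed.

Lemma Nd_sq : N d ^+ 2 = (N S + q) * (N S - 3 * q).
Proof. by rewrite -rmorphXn /= d_sq; push; rewrite Nq opprK mulrN. Qed.

Ltac push_V := push; rewrite ?VV1; [|by const1..]; push; rewrite ?V_euler //.

(** The products [(S - q) (N S + q)], [(S + 3 q) (N S - 3 q)] and [d * N d] are eta quotients in
    [q^2], namely [g1], [g9], [g] at [q^2]. Hence [V2S_mul] can be read at [q] instead of [q^2], as
    a formula for [4 S]. *)
Lemma N_S : N S = S.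
Proof.
pose g1 := f2 ^+ 3 * f3 ^+ 9 / (f1 ^+ 3 * f6 ^+ 9).
pose g9 := f1 ^+ 5 * f3 / (f2 * f6 ^+ 5).
pose g := f1 * f2 * f3 ^+ 5 / f6 ^+ 7.
have Vg1 : V 2 g1 = (S - q) * (N S + q).
  by rewrite S_sub1 NS_add1 /g1; push_V; fps_field.
have Vg9 : V 2 g9 = (S + 3 * q) * (N S - 3 * q).
  by rewrite S_add3 NS_sub3 /g9; push_V; fps_field.
have Vg : V 2 g = d * N d.
  by rewrite Nd_eta d_eta /g; push_V; fps_field.
have e1 : g1 * (S - q) = (N S + q) ^+ 2.
  by rewrite S_sub1 NS_add1 /g1; fps_field.
have e9 : g9 * (S - q) = (N S - 3 * q) ^+ 2.
  by rewrite S_sub1 NS_sub3 /g9; fps_field.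
have e : g * (S - q) = (N S + q) * (N S - 3 * q).
  by rewrite S_sub1 NS_sub3 NS_add1 /g; fps_field.
clearbody g1 g9 g.
have S4 : 4 * S = g1 + g9 + 2 * g + 4 * q.
  apply: (@Vinj 2) => //; push; rewrite Vg1 Vg9 Vg Vq //.
  transitivity (2 * (2 * (V 2 S + q ^+ 2)) - 4 * q ^+ 2); first by ring.
  by rewrite V2S_mul; ring.
(* Times [S - q], the sum [g1 + g9 + 2 g] becomes the square of [(N S + q) + (N S - 3 q)], whence
   [(S - q) ^ 2 = (N S - q) ^ 2]. The second factor below has constant term 2. *)
have eq0 : 4 * ((S - N S) * (S + N S - 2 * q)) = 0.
  transitivity ((4 * S) * (S - q) - 4 * q * (S - q) - (2 * N S - 2 * q) ^+ 2);
    first by ring.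
  rewrite S4; transitivity (g1 * (S - q) + g9 * (S - q) + 2 * (g * (S - q)) -
    (2 * N S - 2 * q) ^+ 2); first by ring.
  by rewrite e1 e9 e; ring.
have {eq0} /eqP := eq0; rewrite !mulf_eq0 (negPf (fps_nat_neq0 3)) /=.
case/orP => [|/eqP/(congr1 (fun f : fps => f 0))].
  by rewrite subr_eq0 => /eqP.
by rewrite fcoefB fcoefD N0 S0 fcoefM0 q0 mulr0.
Qed.

Lemma S_add1 : S + q = f3 ^+ 3 * f4 / (f1 * f12 ^+ 3).
Proof. by rewrite -NS_add1 N_S. Qed.
Lemma S_sub3 : S - 3 * q = f1 ^+ 3 * f4 * f6 ^+ 2 / (f2 ^+ 2 * f3 * f12 ^+ 3).
Proof. by rewrite -NS_sub3 N_S. Qed.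

Lemma dNd : d * N d = 2 * V 2 S + 3 * q ^+ 2 - S ^+ 2.
Proof.
by apply: (addrI ((S + q) * (S - q))); rewrite -{2}N_S -V2S_mul; ring.
Qed.

(** The square of [d * N d] is computed from [dNd] and from [d_sq] and [Nd_sq]; the difference is 4
    times the claim. *)
Lemma V2S_rel : S ^+ 2 * (V 2 S - q ^+ 2) = V 2 S * (V 2 S + 3 * q ^+ 2).
Proof.
apply: (mulfI (fps_nat_neq0 3)); apply/eqP; rewrite -subr_eq0; apply/eqP.
transitivity ((S - q) * (S + 3 * q) * ((S + q) * (S - 3 * q)) -
  (2 * V 2 S + 3 * q ^+ 2 - S ^+ 2) ^+ 2); first by ring.
by rewrite -dNd exprMn d_sq Nd_sq N_S subrr.
Qed.

(* Equality of the coefficients of [q ^ n] reads [2 T n = 0] when [T] is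
   already known to be [1] modulo [q ^ n]. *)
Lemma sqr_eq_V2 (T : fps) : T 0 = 1 -> T ^+ 2 = V 2 T -> T = 1.
Proof.
move=> T0 TE; apply: fpsP => n; rewrite fcoef1.
elim/ltn_ind: n => -[//|n] IHn.
have Tn k : (0 < k < n.+1)%N -> T k = 0.
  by move=> /andP[k0 kn]; rewrite IHn //; case: k k0 {kn}.
have VT : V 2 T n.+1 = 0.
  rewrite /V; case: ifP => // /dvdnP[k kE]; rewrite kE mulnK // Tn //; lia.
move: VT; rewrite -TE expr2 fcoefM big_ord_recl big_ord_recr /= big1 => [|i _].
  by rewrite subn0 subnn T0 mul1r mulr1 add0r /bump /= add1n; lia.
by rewrite Tn ?mul0r //= /bump add1n ltnS /=.
Qed.

(** [v] is $\psi(q)/\psi(q^3)$ and [u] is its square; [S_eta] identifies [S] with [u] at [q^2]. *)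
HB.lock Definition u := f2 ^+ 4 * f3 ^+ 2 / (f1 ^+ 2 * f6 ^+ 4).
HB.lock Definition v := f2 ^+ 2 * f3 / (f1 * f6 ^+ 2).
Lemma uE : u = f2 ^+ 4 * f3 ^+ 2 / (f1 ^+ 2 * f6 ^+ 4).
Proof. by rewrite u.unlock. Qed.
Lemma vE : v = f2 ^+ 2 * f3 / (f1 * f6 ^+ 2).
Proof. by rewrite v.unlock. Qed.

Lemma u0 : u 0 = 1. Proof. by rewrite uE; const1. Qed.
Lemma v0 : v 0 = 1. Proof. by rewrite vE; const1. Qed.

Lemma V2u : V 2 u = f4 ^+ 4 * f6 ^+ 2 / (f2 ^+ 2 * f12 ^+ 4).
Proof. by rewrite uE; push_V. Qed.

Lemma u_sq : u = v ^+ 2.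
Proof. by rewrite uE vE; fps_field. Qed.

(** Since [(S + 3 q) / (S - q)] is the eta quotient [u ^ 2 / V 2 u], the relation [V2S_rel] says
    that [T = S / V 2 u] satisfies [T ^ 2 = V 2 T]. *)
Lemma S_eta : S = V 2 u.
Proof.
have u1 : V 2 u 0 = 1 by rewrite V2u; const1.
have u2 : V 4 u 0 = 1 by rewrite V0 uE; const1.
have U : V 2 u \is a GRing.unit by apply: unit_fps1.
suff T1 : S / V 2 u = 1 by rewrite -(divrK U S) T1 mul1r.
apply: sqr_eq_V2; first by rewrite fcoefM0 fcoefV0 // S0.
have e : V 2 ((S + 3 * q) / (S - q)) = V 2 (u ^+ 2 / V 2 u).
  by rewrite S_add3 S_sub1 V2u uE; congr (V 2 _); fps_field.
have S1 : (S - q) 0 = 1 by rewrite fcoefB S0 q0.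
have S1' : V 2 S - q ^+ 2 \is a GRing.unit.
  by apply: unit_fps1; rewrite fcoefB V0 S0 qX0.
have Se : S ^+ 2 = V 2 S * V 2 ((S + 3 * q) / (S - q)).
  apply: (mulIr S1'); rewrite V2S_rel; push; rewrite VV1 // rmorphB /= Vq //.
  by rewrite mulrA divrK.
rewrite expr_div_n Se e !rmorphM /= !VV1 ?V0 ?u0 //.
by apply: (canLR (mulrK (unitrX 2 U))); ring.
Qed.

(** The square of [d + N d] is [4 V 2 S], a perfect square; the constant term fixes the sign of the
    root. *)
Lemma d_even : d + N d = 2 * V 4 v.
Proof.
have /eqP : (d + N d - 2 * V 4 v) * (d + N d + 2 * V 4 v) = 0.
  transitivity (d ^+ 2 + N d ^+ 2 + 2 * (d * N d) - 4 * V 4 v ^+ 2); first by ring.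
  have -> : V 4 v ^+ 2 = V 2 S by rewrite S_eta Vcomp u_sq rmorphXn.
  by rewrite d_sq Nd_sq N_S dNd; ring.
rewrite mulf_eq0 => /orP[|/eqP/(congr1 (fun f : fps => f 0))].
  by rewrite subr_eq0 => /eqP.
by rewrite !fcoefD N0 d0 fcoefM0 V0 v0 mulr1 fcoef_nat0.
Qed.

(** The odd part follows from the even one, because [(d + N d) (d - N d) = 4 q S]. *)
Lemma d_dissect : d = V 4 v + q * V 2 (u / V 2 v).
Proof.
have V4v : V 4 v 0 = 1 by rewrite V0 v0.
apply: (mulfI (fps_nat_neq0 1)); apply: (mulfI (fps_neq0 V4v)).
have -> : V 2 (u / V 2 v) = S / V 4 v.
  by rewrite rmorphM /= VV1 ?V0 ?v0 // Vcomp S_eta.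
transitivity (V 4 v * (2 * V 4 v) + V 4 v * (d - N d)).
  by rewrite -d_even; ring.
have -> : V 4 v * (d - N d) = 2 * (q * S).
  apply: (mulfI (fps_nat_neq0 1)).
  transitivity ((d + N d) * (d - N d)); first by rewrite d_even; ring.
  transitivity (d ^+ 2 - N d ^+ 2); first by ring.
  by rewrite d_sq Nd_sq N_S; ring.
have U : V 4 v \is a GRing.unit by apply: unit_fps1.
by rewrite -{1}(mulrK U S); ring.
Qed.

(** * Dissections *)

Lemma S_unit (c : fps) : (S + c * q) \is a GRing.unit.
Proof. by apply: unit_fps1; rewrite fcoefD fcoefM0 q0 mulr0 S0. Qed.

(** In the 3-dissection of [theta 1 q] two of the three classes coincide, and the third is
    $2q\psi(q^9)$. *)
Lemma psi_dissect : f2 ^+ 2 / f1 =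
  V 3 (f2 * f3 ^+ 2 / (f1 * f6)) + q * V 3 (f6 ^+ 2 / f3).
Proof.
have psi9 : theta 1 (q ^+ 9) = 2 * V 3 (f6 ^+ 2 / f3).
  have -> : theta 1 (q ^+ 9) = V 9 (theta 1 q).
    by rewrite V_theta ?mul1r ?q0 // rmorph1 Vq.
  by rewrite theta_psi; push_V.
have P3 : theta (q ^+ 3) (q ^+ 6) = V 3 (f2 * f3 ^+ 2 / (f1 * f6)).
  by rewrite -theta_P V_theta ?fcoefM0 ?q0 ?mul0r // rmorphXn /= Vq // -exprM.
apply: (mulfI (fps_nat_neq0 1)); rewrite -theta_psi (@theta_dissect3 1 q) ?mul1r ?q0 //.
rewrite !expr1n !mul1r thetaC psi9 [theta (q ^+ 6) _]thetaC P3; ring.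
Qed.

Lemma phi_dissect3 : f1 ^+ 2 / f2 =
  V 3 (f3 ^+ 2 / f6) - 2 * q * V 3 (f1 * f6 ^+ 2 / (f2 * f3)).
Proof.
have qq0 : (- q * - q : fps) 0 = 0 by rewrite fcoefM0 fcoefN q0.
have phi9 : theta (- q ^+ 9) (- q ^+ 9) = V 3 (f3 ^+ 2 / f6).
  have -> : theta (- q ^+ 9) (- q ^+ 9) = V 9 (theta (- q) (- q)).
    by rewrite V_theta // rmorphN /= Vq.
  by rewrite theta_phiN; push_V.
have b3 : theta (- q ^+ 3) (- q ^+ 15) = V 3 (f1 * f6 ^+ 2 / (f2 * f3)).
  rewrite -theta_b V_theta ?fcoefM0 ?fcoefN ?q0 ?oppr0 ?mul0r //.
  by rewrite !rmorphN rmorphXn /= Vq // -exprM.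
rewrite -theta_phiN (@theta_dissect3 (- q)) //.
have -> : (- q) ^+ 6 * (- q) ^+ 3 = - q ^+ 9 by ring.
have -> : (- q) ^+ 3 * (- q) ^+ 6 = - q ^+ 9 by ring.
have -> : (- q) ^+ 9 * (- q) ^+ 6 = - q ^+ 15 by ring.
have -> : (- q) ^+ 6 * (- q) ^+ 9 = - q ^+ 15 by ring.
have -> : (- q) ^+ 3 = - q ^+ 3 by ring.
rewrite phi9 [theta (- q ^+ 15) _]thetaC b3; ring.
Qed.

(* With [a = phi(-q^3)] and [phi(-q) = a(q^3) - 2 q b(q^3)], the product of
   [phi(-w q)] over the cube roots of unity [w] is [a^3 - 8 q b^3] at [q^3]. *)
Lemma phi_norm :
  (f3 ^+ 2 / f6) ^+ 3 - 8 * q * (f1 * f6 ^+ 2 / (f2 * f3)) ^+ 3 =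
  f1 ^+ 8 * f6 / (f2 ^+ 4 * f3 ^+ 2).
Proof.
have U : (S + q) ^+ 2 \is a GRing.unit by rewrite unitrX // -[q]mul1r S_unit.
apply: (mulIr U); set a3 := (f3 ^+ 2 / f6) ^+ 3; set b3 := (_ / _) ^+ 3.
have b3E : b3 * (S + q) ^+ 2 = a3 * (S - q).
  by rewrite /a3 /b3 S_add1 S_sub1; fps_field.
have nE : f1 ^+ 8 * f6 / (f2 ^+ 4 * f3 ^+ 2) * (S + q) ^+ 2 = a3 * (S - 3 * q) ^+ 2.
  by rewrite /a3 S_add1 S_sub3; fps_field.
(* What remains is [(S + q) ^ 2 - 8 q (S - q) = (S - 3 q) ^ 2]. *)
rewrite nE; transitivity (a3 * (S + q) ^+ 2 - 8 * q * (b3 * (S + q) ^+ 2)); first by ring.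
by rewrite b3E; ring.
Qed.

(** The inverse of [x - y] is [(x ^ 2 + x y + y ^ 2) / (x ^ 3 - y ^ 3)]; with [x = V 3 a] and
    [y = 2 q * V 3 b] the denominator is a series in [q^3], evaluated by [phi_norm]. *)
Lemma phi_inv_dissect : f2 / f1 ^+ 2 =
  V 3 (f2 ^+ 4 * f3 ^+ 6 / (f1 ^+ 8 * f6 ^+ 3)) +
  q * V 3 (2 * (f2 ^+ 3 * f3 ^+ 3 / f1 ^+ 7)) +
  q ^+ 2 * V 3 (4 * (f2 ^+ 2 * f6 ^+ 3 / f1 ^+ 6)).
Proof.
set n := f1 ^+ 8 * f6 / (f2 ^+ 4 * f3 ^+ 2).
set a := f3 ^+ 2 / f6; set b := f1 * f6 ^+ 2 / (f2 * f3).
have -> : f2 ^+ 4 * f3 ^+ 6 / (f1 ^+ 8 * f6 ^+ 3) = a ^+ 2 / n.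
  by rewrite /a /n; fps_field.
have -> : 2 * (f2 ^+ 3 * f3 ^+ 3 / f1 ^+ 7) = 2 * a * b / n.
  by rewrite /a /b /n; fps_field.
have -> : 4 * (f2 ^+ 2 * f6 ^+ 3 / f1 ^+ 6) = 4 * b ^+ 2 / n.
  by rewrite /b /n; fps_field.
have n0 : n 0 = 1 by rewrite /n; const1.
have U : V 3 n \is a GRing.unit by apply: unit_fps1; rewrite V0.
have U' : f1 ^+ 2 / f2 \is a GRing.unit by apply: unit_fps1; const1.
have Vn : V 3 n = V 3 a ^+ 3 - 8 * q ^+ 3 * V 3 b ^+ 3.
  by rewrite /n -phi_norm -/a -/b; clearbody a b; push; rewrite Vq.
have -> : f2 / f1 ^+ 2 = (f1 ^+ 2 / f2)^-1 by fps_field.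
apply: (mulIr U'); rewrite mulVr // phi_dissect3 -/a -/b.
clearbody a b n; push; rewrite !VV1 //.
apply: (mulIr U); rewrite mul1r {1}Vn.
transitivity ((V 3 a ^+ 2 + q * (2 * V 3 a * V 3 b) + q ^+ 2 * (4 * V 3 b ^+ 2)) *
  (V 3 a - 2 * q * V 3 b) * ((V 3 n)^-1 * V 3 n)); last by ring.
by rewrite mulVr //; ring.
Qed.

Lemma phi_neg : N (f1 ^+ 2 / f2) = f2 ^+ 5 / (f1 ^+ 2 * f4 ^+ 2).
Proof.
rewrite rmorphM /= NV1 //; last by const1.
by push; rewrite N_f1 N_euler_even //; fps_field.
Qed.

(** $\varphi(q) = \varphi(q^4) + 2q\psi(q^8)$, by index parity in [theta q q], where [b / a = 1]. *)
Lemma phi_dissect2 : f2 ^+ 5 / (f1 ^+ 2 * f4 ^+ 2) =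
  V 4 (f2 ^+ 5 / (f1 ^+ 2 * f4 ^+ 2)) + 2 * q * V 8 (f2 ^+ 2 / f1).
Proof.
set phi := f2 ^+ 5 / _; set psi := f2 ^+ 2 / f1.
have phiE : phi = theta q q.
  by rewrite /phi -phi_neg -theta_phiN N_theta ?fcoefM0 ?fcoefN ?q0 // rmorphN /= Nq opprK.
have e4 : V 4 phi = theta (q ^+ 4) (q ^+ 4).
  by rewrite phiE V_theta ?fcoefM0 ?q0 // Vq.
have e8 : 2 * V 8 psi = theta 1 (q ^+ 8).
  have -> : theta 1 (q ^+ 8) = V 8 (theta 1 q).
    by rewrite V_theta ?mul1r ?q0 // rmorph1 Vq.
  by rewrite theta_psi -/psi; clearbody psi; push.
rewrite {1}phiE (@theta_dissect2 q q 1) ?mulr1 ?fcoefM0 ?q0 // e4.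
have -> : 2 * q * V 8 psi = q * (2 * V 8 psi) by ring.
by rewrite e8 [theta 1 _]thetaC; congr (theta _ _ + q * theta _ _); ring.
Qed.

(** $\varphi(q)^2 = \varphi(q^2)^2 + 4q\psi(q^4)^2$: insert the 2-dissection into
    $\varphi(q)\varphi(-q) = \varphi(-q^2)^2$, read it at [q] instead of [q^2], and change the sign
    of [q]. *)
Lemma phi_sq_dissect : (f2 ^+ 5 / (f1 ^+ 2 * f4 ^+ 2)) ^+ 2 =
  V 2 ((f2 ^+ 5 / (f1 ^+ 2 * f4 ^+ 2)) ^+ 2) + q * V 2 (4 * V 2 (f2 ^+ 2 / f1) ^+ 2).
Proof.
set phi := f2 ^+ 5 / _; set psi := f2 ^+ 2 / f1.
set phim := f1 ^+ 2 / f2.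
have Nphi : N phi = phim by rewrite /phi -phi_neg NK.
have mE : phi * phim = V 2 (phim ^+ 2).
  by rewrite /phi /phim; push_V; fps_field.
have dE : phi = V 4 phi + 2 * q * V 8 psi by exact: phi_dissect2.
have NdE : phim = V 4 phi - 2 * q * V 8 psi.
  rewrite -Nphi {1}dE rmorphD !rmorphM /= !NV_even // Nq rmorph_nat; ring.
clearbody phi psi phim.
have msq : phim ^+ 2 = V 2 phi ^+ 2 - 4 * q * V 4 psi ^+ 2.
  apply: (@Vinj 2) => //; rewrite -mE {1}dE {1}NdE; push.
  by rewrite !Vcomp Vq //; ring.
have sqE : phi ^+ 2 = N (phim ^+ 2) by rewrite -Nphi; push; rewrite NK.
rewrite [LHS]sqE msq; push; rewrite !NV_even // Nq [V 2 (V 2 psi)]Vcomp; ring.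
Qed.

(** * Eta quotients with vanishing coefficients *)

HB.lock Definition w := f2 ^+ 5 * f3 ^+ 2 / (f1 ^+ 2 * f4 ^+ 4 * f6).
Lemma wE : w = f2 ^+ 5 * f3 ^+ 2 / (f1 ^+ 2 * f4 ^+ 4 * f6).
Proof. by rewrite w.unlock. Qed.

(* [w] is [phi(q) phi(-q^3) / f4^2], and it is [(S + q) d] up to a series in
   [q^2]. *)
Lemma w_dissect : exists B,
  w = V 2 (V 2 (f3 ^+ 2 / (f2 * f6))) + q * V 2 B.
Proof.
pose m := f1 ^+ 3 * f6 ^+ 7 / (f2 ^+ 5 * f3 ^+ 5).
pose t := u / V 2 v.
exists (m * (V 2 v + u * t)).
have -> : w = V 2 m * ((S + q) * d).
  by rewrite wE S_add1 d_eta /m; push_V; fps_field.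
have U : V 2 v \is a GRing.unit by apply: unit_fps1; rewrite V0 v0.
(* The even part of [(S + q) d] is [u V 2 v + q t] at [q^2]. It factors because [S] is the square of
   [V 2 v], so the even part of [w] is again an eta quotient. *)
have tE : u * V 2 v + q * t = (S + q) * t.
  have tv : t * V 2 v = u by rewrite /t divrK.
  have -> : S = V 2 v ^+ 2 by rewrite S_eta u_sq rmorphXn.
  by rewrite -{1}tv; clearbody t; ring.
have -> : V 2 (V 2 (f3 ^+ 2 / (f2 * f6))) = V 2 (m * (u * V 2 v + q * t)).
  rewrite tE S_add1 /t /m uE vE; congr (V 2 _).
  by push_V; fps_field.
rewrite d_dissect -/t S_eta; clearbody m t; push; rewrite Vcomp Vq //; ring.
Qed.

Lemma dissect2_even a b n : (V 2 a + q * V 2 b) (2 * n)%N = a n.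
Proof.
rewrite fcoefD coef_VM // coef_qM; case: n => [|n]; first by rewrite addr0.
have -> : (2 * n.+1)%N = (2 * n + 1).+1 by lia.
by rewrite coef_Vr ?addr0.
Qed.

Lemma dissect2_odd a b n : (V 2 a + q * V 2 b) (2 * n + 1)%N = b n.
Proof. by rewrite fcoefD coef_Vr // addn1 coef_qM coef_VM // add0r. Qed.

Section Dissect3.
Variables (a b c : fps) (n : nat).
Let f := V 3 a + q * V 3 b + q ^+ 2 * V 3 c.

Lemma dissect3_0 : f (3 * n)%N = a n.
Proof.
rewrite /f !fcoefD coef_VM // coef_qM coef_qXM; case: n => [|k].
  by rewrite !addr0.
have -> : (3 * k.+1)%N = (3 * k + 2).+1 by lia.
have -> : ((3 * k + 2).+1 - 2)%N = (3 * k + 1)%N by lia.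
by rewrite !coef_Vr // if_same !addr0.
Qed.

Lemma dissect3_1 : f (3 * n + 1)%N = b n.
Proof.
rewrite /f !fcoefD coef_Vr // {1}addn1 coef_qM coef_VM // coef_qXM add0r.
case: n => [|k]; first by rewrite addr0.
have -> : (3 * k.+1 + 1 - 2)%N = (3 * k + 2)%N by lia.
by rewrite coef_Vr // if_same addr0.
Qed.

Lemma dissect3_2 : f (3 * n + 2)%N = c n.
Proof.
rewrite /f !fcoefD coef_Vr // coef_qXM addnK coef_VM // ltnNge leq_addl add0r /=.
by rewrite (_ : 3 * n + 2 = (3 * n + 1).+1)%N ?coef_qM ?coef_Vr ?add0r //; lia.
Qed.
End Dissect3.

Lemma w_2mod4 n : w (4 * n + 2)%N = 0.
Proof.
have [B ->] := w_dissect; rewrite (_ : 4 * n + 2 = 2 * (2 * n + 1))%N; last by lia.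
by rewrite dissect2_even coef_Vr.
Qed.

(** The quotient is $\varphi(q)^2$ times a series in [q^2], and its even part is [w] at [q^2]. *)
Lemma big_4mod8 n :
  (f2 ^+ 12 * f6 ^+ 2 / (f1 ^+ 4 * f4 ^+ 9 * f12)) (8 * n + 4)%N = 0.
Proof.
pose g := f1 ^+ 2 * f3 ^+ 2 / (f2 ^+ 5 * f6).
have -> : f2 ^+ 12 * f6 ^+ 2 / (f1 ^+ 4 * f4 ^+ 9 * f12) =
    (f2 ^+ 5 / (f1 ^+ 2 * f4 ^+ 2)) ^+ 2 * V 2 g.
  by rewrite /g; push_V; fps_field.
rewrite phi_sq_dissect; set phi := f2 ^+ 5 / _; set psi := f2 ^+ 2 / f1.
have -> : (V 2 (phi ^+ 2) + q * V 2 (4 * V 2 psi ^+ 2)) * V 2 g =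
    V 2 (phi ^+ 2 * g) + q * V 2 (4 * V 2 psi ^+ 2 * g).
  by clearbody phi psi g; push; ring.
have -> : phi ^+ 2 * g = w by rewrite wE /phi /g; fps_field.
rewrite (_ : 8 * n + 4 = 2 * (4 * n + 2))%N; last by lia.
by rewrite dissect2_even w_2mod4.
Qed.

Lemma psi3_dissect (c : fps) : f2 ^+ 2 / f1 * V 3 c =
  V 3 (f2 * f3 ^+ 2 / (f1 * f6) * c) + q * V 3 (f6 ^+ 2 / f3 * c) + q ^+ 2 * V 3 0.
Proof.
rewrite psi_dissect !rmorphM raddf0 /=; ring.
Qed.

Lemma v_2mod3 n : v (3 * n + 2)%N = 0.
Proof.
have -> : v = f2 ^+ 2 / f1 * V 3 (f1 / f2 ^+ 2).
  by rewrite vE; push_V; fps_field.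
by rewrite psi3_dissect dissect3_2.
Qed.

(** The terms of [v ^ 3] with exponents divisible by 3 form [v] at [q^3], because
    [(S + q) ^ 2 + q (S - q) = S (S + 3 q)]; then [v_2mod3] applies. *)
Lemma v3_6mod9 n : (v ^+ 3) (9 * n + 6)%N = 0.
Proof.
set P := f2 * f3 ^+ 2 / (f1 * f6); set R := f6 ^+ 2 / f3.
pose g := f1 ^+ 3 / f2 ^+ 6.
have vgE : v ^+ 3 = (f2 ^+ 2 / f1) ^+ 3 * V 3 g.
  by rewrite vE /g; push_V; fps_field.
have U : (S + q) ^+ 2 \is a GRing.unit by rewrite unitrX // -[q]mul1r S_unit.
have gE : (P ^+ 3 + q * R ^+ 3) * g = v.
  apply: (mulIr U).
  have RE : R ^+ 3 * (S + q) ^+ 2 = P ^+ 3 * (S - q).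
    by rewrite /P /R S_add1 S_sub1; fps_field.
  transitivity ((P ^+ 3 * (S + q) ^+ 2 + q * (R ^+ 3 * (S + q) ^+ 2)) * g); first by ring.
  rewrite RE; transitivity (P ^+ 3 * (S * (S + 3 * q)) * g); first by ring.
  by rewrite S_add1 S_add3 S_eta V2u /P /g vE; fps_field.
have -> : v ^+ 3 = V 3 v + q * V 3 (3 * P ^+ 2 * R * g) + q ^+ 2 * V 3 (3 * P * R ^+ 2 * g).
  rewrite vgE psi_dissect -/P -/R -gE; clearbody P R g; push; rewrite Vq //; ring.
rewrite (_ : 9 * n + 6 = 3 * (3 * n + 2))%N; last by lia.
by rewrite dissect3_0 v_2mod3.
Qed.

Lemma S_unit1 : S + q \is a GRing.unit.
Proof. by rewrite -[q]mul1r S_unit. Qed.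

(** The series is $\psi(q)^2/\varphi(-q^2)$ times a series in [q^3], so the dissections of the two
    theta functions are multiplied; [al], [be], [ga] come from $1/\varphi(-q^2)$. *)
Lemma Sd_dissect : exists C, (S + q) * d =
  V 3 (f2 ^+ 12 * f6 ^+ 2 / (f1 ^+ 4 * f4 ^+ 9 * f12)) + q * V 3 (2 * w) +
  q ^+ 2 * V 3 C.
Proof.
pose P := f2 * f3 ^+ 2 / (f1 * f6); pose R := f6 ^+ 2 / f3.
pose G := f1 ^+ 2 * f2 ^+ 4 / f4 ^+ 7.
pose al := f4 ^+ 4 * f6 ^+ 6 / (f2 ^+ 8 * f12 ^+ 3).
pose be := f4 ^+ 3 * f6 ^+ 3 / f2 ^+ 7.
pose ga := f4 ^+ 2 * f12 ^+ 3 / f2 ^+ 6.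
have phi2 : f4 / f2 ^+ 2 =
    V 3 al + q ^+ 2 * V 3 (2 * be) + q ^+ 4 * V 3 (4 * ga).
  have -> : f4 / f2 ^+ 2 = V 2 (f2 / f1 ^+ 2) by push_V.
  rewrite phi_inv_dissect /al /be /ga; push_V; rewrite Vq //.
  by rewrite -!exprM.
have RE : P * R * be * (S + q) = P ^+ 2 * al.
  by rewrite /P /R /al /be S_add1; fps_field.
have RE2 : R ^+ 2 * ga * (S + q) ^+ 2 = P ^+ 2 * al.
  by rewrite /P /R /al /ga S_add1; fps_field.
have PE : P ^+ 2 * ga * (S - q) = P * R * al.
  by rewrite /P /R /al /ga S_sub1; fps_field.
have RE3 : R ^+ 2 * be * (S + q) = P * R * al.
  by rewrite /P /R /al /be S_add1; fps_field.
have U := S_unit1.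
have res0 : (P ^+ 2 * al + 4 * q * (P * R * be) + 4 * q ^+ 2 * (R ^+ 2 * ga)) * G =
    f2 ^+ 12 * f6 ^+ 2 / (f1 ^+ 4 * f4 ^+ 9 * f12).
  apply: (mulIr (unitrX 2 U)).
  transitivity ((P ^+ 2 * al * (S + q) ^+ 2 + 4 * q * (S + q) * (P * R * be * (S + q)) +
    4 * q ^+ 2 * (R ^+ 2 * ga * (S + q) ^+ 2)) * G); first by ring.
  (* The sum collapses by [(S + q) ^ 2 + 4 q (S + q) + 4 q ^ 2 = (S + 3 q) ^ 2]. *)
  rewrite RE RE2; transitivity (P ^+ 2 * al * (S + 3 * q) ^+ 2 * G); first by ring.
  by rewrite /P /al /G S_add3 S_add1; fps_field.
have res1 : (P * R * al + 2 * q * (P ^+ 2 * ga) + q * (R ^+ 2 * be)) * G = w.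
  have U' : S - q \is a GRing.unit by rewrite -mulN1r S_unit.
  apply: (mulIr U); apply: (mulIr U').
  transitivity ((P * R * al * (S - q) * (S + q) + 2 * q * (S + q) * (P ^+ 2 * ga * (S - q)) +
    q * (S - q) * (R ^+ 2 * be * (S + q))) * G); first by ring.
  rewrite PE RE3; transitivity (P * R * al * (S * (S + 3 * q)) * G); first by ring.
  by rewrite /P /R /al /G S_add3 S_sub1 S_add1 S_eta V2u wE; fps_field.
exists ((R ^+ 2 * al + 2 * P ^+ 2 * be + 8 * q * P * R * ga) * G).
have -> : (S + q) * d = (f2 ^+ 2 / f1) ^+ 2 * (f4 / f2 ^+ 2) * V 3 G.
  by rewrite S_add1 d_eta /G; push_V; fps_field.
rewrite psi_dissect -/P -/R phi2 -res0 -res1; clearbody P R G al be ga.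
by push; rewrite Vq //; ring.
Qed.

Lemma Sd_7mod12 n : ((S + q) * d) (12 * n + 7)%N = 0.
Proof.
have [C ->] := Sd_dissect; rewrite (_ : 12 * n + 7 = 3 * (4 * n + 2) + 1)%N; last by lia.
by rewrite dissect3_1 mulr_natl fcoefMn w_2mod4 mul0rn.
Qed.

Lemma Sd_12mod24 n : ((S + q) * d) (24 * n + 12)%N = 0.
Proof.
have [C ->] := Sd_dissect; rewrite (_ : 24 * n + 12 = 3 * (8 * n + 4))%N; last by lia.
by rewrite dissect3_0 big_4mod8.
Qed.

(** The components of the 3-dissections: [e0], [e1], [e2] for [S + q], and [w], [d1], 0 for [d]. *)
HB.lock Definition e0 := f6 ^+ 4 / (f4 ^+ 2 * f12 ^+ 2).
HB.lock Definition e1 := f2 ^+ 2 * f3 ^+ 3 * f12 / (f1 * f4 ^+ 3 * f6 ^+ 2).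
HB.lock Definition e2 := 2 * (f2 * f6 * f12 / f4 ^+ 3).
HB.lock Definition d1 := f2 ^+ 4 * f6 ^+ 2 / (f1 * f3 * f4 ^+ 4).
Lemma e0E : e0 = f6 ^+ 4 / (f4 ^+ 2 * f12 ^+ 2). Proof. by rewrite e0.unlock. Qed.
Lemma e1E : e1 = f2 ^+ 2 * f3 ^+ 3 * f12 / (f1 * f4 ^+ 3 * f6 ^+ 2).
Proof. by rewrite e1.unlock. Qed.
Lemma e2E : e2 = 2 * (f2 * f6 * f12 / f4 ^+ 3). Proof. by rewrite e2.unlock. Qed.
Lemma d1E : d1 = f2 ^+ 4 * f6 ^+ 2 / (f1 * f3 * f4 ^+ 4).
Proof. by rewrite d1.unlock. Qed.

Lemma d_dissect3 : d = V 3 w + q * V 3 d1 + q ^+ 2 * V 3 0.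
Proof.
have -> : d = f2 ^+ 2 / f1 * V 3 (f2 ^+ 4 / (f1 * f4 ^+ 4)).
  by rewrite d_eta; push_V; fps_field.
rewrite psi3_dissect wE d1E.
by congr (V 3 _ + q * V 3 _ + _); fps_field.
Qed.

Lemma d_2mod3 n : d (3 * n + 2)%N = 0.
Proof. by rewrite d_dissect3 dissect3_2. Qed.

(** [S + q] is $\psi(-q)/\varphi(-q)$ times a series in [q^3]. Each component is a difference of two
    eta quotients, collapsed by clearing [S + q]. *)
Lemma S_dissect3 : S + q = V 3 e0 + q * V 3 e1 + q ^+ 2 * V 3 e2.
Proof.
pose P := f1 * f4 * f6 ^+ 5 / (f2 ^+ 2 * f3 ^+ 2 * f12 ^+ 2).
pose R := f3 * f12 / f6; pose G := f1 ^+ 3 / f4 ^+ 3.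
pose al := f2 ^+ 4 * f3 ^+ 6 / (f1 ^+ 8 * f6 ^+ 3).
pose be := f2 ^+ 3 * f3 ^+ 3 / f1 ^+ 7.
pose ga := f2 ^+ 2 * f6 ^+ 3 / f1 ^+ 6.
have psiN : f1 * f4 / f2 = V 3 P - q * V 3 R.
  have -> : f1 * f4 / f2 = N (f2 ^+ 2 / f1).
    rewrite rmorphM /= NV1; last by const1.
    by push; rewrite N_f1 N_euler_even //; fps_field.
  rewrite psi_dissect rmorphD rmorphM /= !NV_odd // Nq mulNr.
  congr (V 3 _ - q * V 3 _).
    rewrite /P rmorphM /= NV1; last by const1.
    by push; rewrite N_f1 N_f3 !N_euler_even //; fps_field.
  rewrite /R rmorphM /= NV1; last by const1.
  by push; rewrite N_f3 !N_euler_even //; fps_field.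
have U := S_unit1.
have E0 : (P * al - 4 * q * (R * ga)) * G = e0.
  apply: (mulIr U).
  have RE : R * ga * (S + q) = P * al.
    by rewrite /P /R /al /ga S_add1; fps_field.
  transitivity ((P * al * (S + q) - 4 * q * (R * ga * (S + q))) * G); first by ring.
  rewrite RE; transitivity (P * al * (S - 3 * q) * G); first by ring.
  by rewrite /P /al /G S_sub3 S_add1 e0E; fps_field.
have E1 : (2 * (P * be) - R * al) * G = e1.
  apply: (mulIr U).
  have PE : P * be * (S + q) = R * al * (S - q).
    by rewrite /P /R /al /be S_add1 S_sub1; fps_field.
  transitivity ((2 * (P * be * (S + q)) - R * al * (S + q)) * G); first by ring.
  rewrite PE; transitivity (R * al * (S - 3 * q) * G); first by ring.
  by rewrite /R /al /G S_sub3 S_add1 e1E; fps_field.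
have E2 : (4 * (P * ga) - 2 * (R * be)) * G = e2.
  apply: (mulIr U).
  have PE : P * ga * (S + q) = R * be * (S - q).
    by rewrite /P /R /ga /be S_add1 S_sub1; fps_field.
  transitivity ((4 * (P * ga * (S + q)) - 2 * (R * be) * (S + q)) * G); first by ring.
  rewrite PE; transitivity (2 * (R * be * (S - 3 * q) * G)); first by ring.
  by rewrite /R /be /G S_sub3 S_add1 e2E; fps_field.
have -> : S + q = f1 * f4 / f2 * (f2 / f1 ^+ 2) * V 3 G.
  by rewrite S_add1 /G; push_V; fps_field.
rewrite psiN phi_inv_dissect -/al -/be -/ga -E0 -E1 -E2; clearbody P R G al be ga.
by push; rewrite Vq //; ring.
Qed.

Lemma V2_odd f n : V 2 f (2 * n + 1)%N = 0. Proof. exact: coef_Vr. Qed.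

Lemma coef_nM (k : nat) (f : fps) n : (k%:R * f) n = f n *+ k.
Proof. by rewrite mulr_natl fcoefMn. Qed.

Lemma coef_sub_inv (G : fps) k n :
  (G - q ^+ k / G) (n + k)%N = G (n + k)%N - G^-1 n.
Proof. by rewrite fcoefB coef_qXM ltnNge leq_addl addnK. Qed.

Lemma coef_add_inv (G : fps) k n :
  (G + q ^+ k / G) (n + k)%N = G (n + k)%N + G^-1 n.
Proof. by rewrite fcoefD coef_qXM ltnNge leq_addl addnK. Qed.

(** These relations between the components, read at [q], turn the bilinear combinations for [m = 3]
    into polynomials in [S] times an eta quotient. *)
Lemma e1_S : e1 * S = S + q.
Proof. by rewrite S_add1 S_eta V2u e1E; fps_field. Qed.
Lemma d1_S : d1 * S = d.
Proof. by rewrite d_eta S_eta V2u d1E; fps_field. Qed.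
Lemma e0_d : e0 * d = w * (S - q).
Proof. by rewrite S_sub1 d_eta e0E wE; fps_field. Qed.
Lemma Sunit : S \is a GRing.unit. Proof. exact: unit_fps1 S0. Qed.
Lemma dunit : d \is a GRing.unit. Proof. exact: unit_fps1 d0. Qed.

(** * The series for [m = 3] *)

Definition Dp := (S + q) * V 3 (S + q) - d * V 3 d.
Definition Dm := (S + q) * V 3 d - d * V 3 (S + q).

(** [V 3 (S + q)] and [V 3 d] act as scalars on the 3-dissection, so the components are those of
    [S + q] times [S + q] minus those of [d] times [d], read at [q^3]. *)
Lemma Dp_dissect : Dp =
  V 3 (- 2 * q * e0) + q * V 3 (4 * q ^+ 2 / S) + q ^+ 2 * V 3 (e2 * (S + q)).
Proof.
have -> : - 2 * q * e0 = e0 * (S + q) - w * d.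
  apply: (mulIr dunit); transitivity (- 2 * q * (e0 * d)); first by ring.
  rewrite e0_d; transitivity (e0 * d * (S + q) - w * d ^+ 2); last by ring.
  by rewrite d_sq e0_d; ring.
have -> : 4 * q ^+ 2 / S = e1 * (S + q) - d1 * d.
  apply: (mulIr Sunit); rewrite divrK ?Sunit //.
  transitivity (e1 * S * (S + q) - d1 * S * d); last by ring.
  by rewrite e1_S d1_S; transitivity ((S + q) ^+ 2 - d ^+ 2); [rewrite d_sq|]; ring.
by rewrite /Dp {1}S_dissect3 {1}d_dissect3 !rmorphB !rmorphM raddf0 /=; ring.
Qed.

Lemma Dm_dissect : Dm = V 3 (- 2 * q * w) + q * V 3 0 + q ^+ 2 * V 3 (e2 * d).
Proof.
have -> : - 2 * q * w = e0 * d - w * (S + q) by rewrite e0_d; ring.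
have -> : 0 = e1 * d - d1 * (S + q).
  apply: (mulIr Sunit); rewrite mul0r.
  transitivity (e1 * S * d - d1 * S * (S + q)); last by ring.
  by rewrite e1_S d1_S; ring.
by rewrite /Dm {1}S_dissect3 {2}d_dissect3 !rmorphB !rmorphM raddf0 /=; ring.
Qed.

Lemma DpDm_dissect : exists B, Dp * Dm =
  V 3 (4 * q ^+ 2 * (f2 ^+ 12 * f6 ^+ 2 / (f1 ^+ 4 * f4 ^+ 9 * f12))) + q * V 3 B +
  q ^+ 2 * V 3 (- 4 * q * (e2 * w * S)).
Proof.
exists (- 2 * q * (4 * q ^+ 2 / S) * w + q * (e2 * (S + q)) * (e2 * d)).
have -> : f2 ^+ 12 * f6 ^+ 2 / (f1 ^+ 4 * f4 ^+ 9 * f12) = e0 * w + q * (e2 * d / S).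
  have eE : e2 * d / S * (S + q) = 2 * (e0 * w).
    by rewrite S_add1 d_eta S_eta V2u e0E e2E wE; fps_field.
  apply: (mulIr S_unit1).
  transitivity (e0 * w * (S + q) + q * (e2 * d / S * (S + q))); last by ring.
  rewrite eE; transitivity (e0 * w * (S + 3 * q)); last by ring.
  by rewrite S_add1 S_add3 e0E wE; fps_field.
have -> : - 4 * q * (e2 * w * S) =
    - 2 * q * e0 * (e2 * d) + e2 * (S + q) * (- 2 * q * w).
  transitivity (- 2 * q * e2 * (e0 * d) + e2 * (S + q) * (- 2 * q * w)); last by ring.
  by rewrite e0_d; ring.
rewrite Dp_dissect Dm_dissect raddf0; move: S^-1 => Si.
by push; rewrite Vq //; ring.
Qed.

(** Taking even parts twice, first by [w_dissect] and then by [S = V 2 u], leaves [2 v], which has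
    no exponent 2 modulo 3. *)
Lemma e2wS_8mod12 n : (e2 * w * S) (12 * n + 8)%N = 0.
Proof.
have [B wB] := w_dissect.
pose g := f2 * f3 ^+ 3 / (f1 * f6 ^+ 3).
pose h := f1 * f6 ^+ 2 / (f2 ^+ 2 * f3).
pose k := f3 ^+ 2 / (f2 * f6).
have -> : e2 * w * S = V 2 (2 * (V 2 k * g)) + q * V 2 (2 * (B * g)).
  have -> : e2 * w * S = 2 * (w * V 2 g).
    by rewrite e2E S_eta V2u /g wE; push_V; fps_field.
  by rewrite wB -/k; clearbody k g; push; ring.
rewrite (_ : 12 * n + 8 = 2 * (6 * n + 4))%N; last by lia.
rewrite dissect2_even coef_nM.
have -> : V 2 k * g = V 2 (u * h) + q * V 2 h.
  have -> : V 2 (u * h) + q * V 2 h = (S + q) * V 2 h.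
    by rewrite S_eta rmorphM /=; ring.
  by rewrite S_add1 /g /h /k; push_V; fps_field.
rewrite (_ : 6 * n + 4 = 2 * (3 * n + 2))%N; last by lia.
rewrite dissect2_even (_ : u * h = v) ?v_2mod3 ?mul0rn //.
by rewrite uE /h vE; fps_field.
Qed.

Definition G3 := V 3 F / F.

Lemma G30 : G3 0 = 1. Proof. by rewrite /G3 fcoefM0 V0 fcoefV0 F0. Qed.

(** Expanding [(x + 1/x) (y + 1/y) - (x - 1/x) (y - 1/y) = 2 (x/y + y/x)] with [x = F / q] and
    [y = V 3 F / q ^ 3], cleared of denominators. *)
Lemma DpE : 2 * q ^+ 2 * (G3 + q ^+ 4 / G3) = Dp.
Proof.
rewrite /Dp SE dE subrK /G3; push; rewrite VV1 ?F0 // Vq //.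
have [K [i inj]] := fps_embeds.
have VF1 : i (V 3 F) != 0 by apply: rmorph_neq0 => //; rewrite V0 F0.
have F1 : i F != 0 by apply: rmorph_neq0 => //; rewrite F0.
apply: (inj); push; rewrite !rmorph_unitV ?fcoefM0 ?V0 ?fcoefV0 ?F0 //; push.
rewrite !rmorph_unitV ?fcoefM0 ?V0 ?fcoefV0 ?F0 //.
by field; rewrite ?VF1 ?F1.
Qed.

Lemma DmE : 2 * q ^+ 2 * (G3 - q ^+ 4 / G3) = Dm.
Proof.
rewrite /Dm SE dE subrK /G3; push; rewrite VV1 ?F0 // Vq //.
have [K [i inj]] := fps_embeds.
have VF1 : i (V 3 F) != 0 by apply: rmorph_neq0 => //; rewrite V0 F0.
have F1 : i F != 0 by apply: rmorph_neq0 => //; rewrite F0.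
apply: (inj); push; rewrite !rmorph_unitV ?fcoefM0 ?V0 ?fcoefV0 ?F0 //; push.
rewrite !rmorph_unitV ?fcoefM0 ?V0 ?fcoefV0 ?F0 //.
by field; rewrite ?VF1 ?F1.
Qed.

Lemma coef_2q2M (f : fps) n : (2 * q ^+ 2 * f) (n + 2)%N = f n *+ 2.
Proof. by rewrite -mulrA coef_nM coef_qXM ltnNge leq_addl addnK. Qed.

(** * The series [xi4] *)

Definition J := F ^+ 2 * N F.

(** The same bilinear expansion for [F ^ 2] and [N F], using [F ^ 2 + q ^ 4 / F ^ 2 = (S + q) ^ 2 -
    2 q ^ 2]. *)
Lemma J_add : 2 * (J + q ^+ 6 / J) =
  ((S + q) ^+ 2 - 2 * q ^+ 2) * (S - q) + (S + q) * (d * N d).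
Proof.
rewrite -{2}N_S NF_add NF_sub SE dE subrK /J.
have [K [i inj]] := fps_embeds.
have F1 : i F != 0 by apply: rmorph_neq0 => //; rewrite F0.
have NF1 : i (N F) != 0 by apply: rmorph_neq0 => //; rewrite N0 F0.
apply: (inj); push; rewrite !rmorph_unitV ?fcoefM0 ?fcoefX0 ?N0 ?F0 //; push.
by field; rewrite ?NF1 ?F1.
Qed.

Lemma J_sub : 2 * (J - q ^+ 6 / J) =
  ((S + q) ^+ 2 - 2 * q ^+ 2) * N d + (S + q) * (S - q) * d.
Proof.
rewrite -{3}N_S NF_add NF_sub SE dE subrK /J.
have [K [i inj]] := fps_embeds.
have F1 : i F != 0 by apply: rmorph_neq0 => //; rewrite F0.
have NF1 : i (N F) != 0 by apply: rmorph_neq0 => //; rewrite N0 F0.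
apply: (inj); push; rewrite !rmorph_unitV ?fcoefM0 ?fcoefX0 ?N0 ?F0 //; push.
by field; rewrite ?NF1 ?F1.
Qed.

Lemma J_add_dissect : J + q ^+ 6 / J = V 2 (u * V 2 u) + q * V 2 (V 2 u) + 2 * q ^+ 3.
Proof.
apply: (mulfI (fps_nat_neq0 1)); rewrite J_add dNd S_eta; push; ring.
Qed.

(** With [d = A + q B] one has [A B = S] and [A ^ 2 = V 2 S]. Multiplied by [A = V 4 v], the right
    side of [J_sub] is a polynomial in [q], [S] and [V 2 S], and [V2S_rel] makes it divisible by
    [V 2 S]. *)
Lemma J_sub_dissect : J - q ^+ 6 / J =
  V 2 (V 2 (v ^+ 3) + q * V 2 (2 * v)) + q * V 2 (u * V 2 v).
Proof.
have V4v : V 4 v 0 = 1 by rewrite V0 v0.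
apply: (mulfI (fps_nat_neq0 1)); apply: (mulfI (fps_neq0 V4v)); rewrite J_sub.
pose t := u / V 2 v.
have tv : V 4 v * V 2 t = S.
  rewrite S_eta -[V 4 v](Vcomp 2 2) -rmorphM /= mulrC /t divrK //.
  by apply: unit_fps1; rewrite V0 v0.
have dE1 : d = V 4 v + q * V 2 t by exact: d_dissect.
have dE2 : N d = V 4 v - q * V 2 t.
  by rewrite dE1 rmorphD rmorphM /= !NV_even // Nq mulNr.
have ev2 : V 4 v ^+ 2 = V 2 S by rewrite S_eta Vcomp u_sq rmorphXn.
transitivity (2 * (S ^+ 2 - q ^+ 2) * V 4 v ^+ 2 + 2 * q * S * V 4 v ^+ 2 -
    2 * q ^+ 2 * S * (V 4 v * V 2 t)).
  by rewrite dE2 dE1; ring.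
rewrite tv ev2; transitivity (2 * (S ^+ 2 * (V 2 S - q ^+ 2)) - 2 * q ^+ 2 * V 2 S +
    2 * q * S * V 2 S); first by ring.
rewrite V2S_rel -ev2 (S_eta).
push; rewrite !Vcomp Vq //; ring.
Qed.

(** * The coefficients of xi *)

Lemma fps_mulE (f g : fps) : fps_mul f g = f * g. Proof. by []. Qed.

Lemma XqE : Xq = thX / f1.
Proof.
rewrite /Xq fps_divE ?qpoch0 // !fps_mulE !qpochE // thXE (eulerE 12) (eulerE 1).
by rewrite expr1.
Qed.

Lemma YqE : Yq = thY / f1.
Proof.
by rewrite /Yq fps_divE ?qpoch0 // !fps_mulE !qpochE // thYE (eulerE 12) (eulerE 1).
Qed.

Lemma Yq_Xq : Yq / Xq = F.
Proof. by rewrite XqE YqE FE; fps_field. Qed.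

Lemma Xq_unit : Xq \is a GRing.unit. Proof. exact: unit_fps1 Xq0. Qed.
Lemma xi1E k : xi 1 k = F ^+ k.
Proof.
by rewrite /xi /= fps_divE ?fps_expE ?fcoefX0 ?Xq0 ?expr1n // -expr_div_n Yq_Xq.
Qed.

Lemma VF_div m : V m F = V m Yq / V m Xq.
Proof. by rewrite -Yq_Xq rmorphM /= VV1 ?Xq0. Qed.

Lemma xiE m k : m != 1%N -> xi m k = (V m F / F) ^+ k.
Proof.
move=> m1; rewrite /xi (negPf m1) !fps_mulE !fps_expE.
have VX1 : V m Xq 0 = 1 by rewrite V0 Xq0.
rewrite fps_divE; last first.
  by rewrite fcoefM0 V0 !fcoefX0 Xq0 Yq0 !expr1n mulr1.
rewrite !rmorphXn /= -!exprMn -expr_div_n VF_div -Yq_Xq; congr (_ ^+ k).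
move: Xq Yq Xq0 Yq0 VX1 => X Y X1 Y1 VX1.
have [K [i inj]] := fps_embeds.
have Xi := rmorph_neq0 inj X1; have Yi := rmorph_neq0 inj Y1.
have VXi := rmorph_neq0 inj VX1.
apply: (inj); push.
rewrite !rmorph_unitV ?fcoefM0 ?fcoefV0 ?VX1 ?X1 ?Y1 //; push.
rewrite !rmorph_unitV ?VX1 ?X1 ?Y1 //.
by field; rewrite ?VXi ?Xi ?Yi.
Qed.

(** By [V2F], the quotient [V 2 F / F] is [N F]. *)
Lemma xi2E k : xi 2 k = N (F ^+ k).
Proof.
rewrite xiE // V2F mulrAC divrr ?mul1r ?rmorphXn //.
by apply: unit_fps1; rewrite F0.
Qed.

Lemma xi3E k : xi 3 k = G3 ^+ k. Proof. exact: xiE. Qed.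

Lemma xi4E : xi4 = J.
Proof.
rewrite /xi4 !fps_mulE fps_divE; last by rewrite fcoefM0 V0 Xq0 mulr1.
rewrite invrM ?Xq_unit //; last by apply: unit_fps1; rewrite V0 Xq0.
transitivity (Yq / Xq * (V 2 Yq / V 2 Xq)); first by ring.
by rewrite -VF_div Yq_Xq V2F /J; ring.
Qed.

Lemma xi'E m k : xi' m k = (xi m k)^-1. Proof. by rewrite /xi' fps_invE ?xi0. Qed.
Lemma xi4'E : xi4' = xi4^-1. Proof. by rewrite /xi4' fps_invE ?xi40. Qed.

Lemma inv_coef_sub (G : fps) k n m : m = (n + k)%N ->
  (G - q ^+ k / G) m = 0 -> G m = G^-1 n.
Proof. by move=> ->; rewrite coef_sub_inv => /eqP; rewrite subr_eq0 => /eqP. Qed.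

Lemma inv_coef_add (G : fps) k n m : m = (n + k)%N ->
  (G + q ^+ k / G) m = 0 -> G m = - G^-1 n.
Proof. by move=> ->; rewrite coef_add_inv => /eqP; rewrite addr_eq0 => /eqP. Qed.

(** * The vanishing coefficients behind the claims *)

Lemma F_add : F + q ^+ 2 / F = S + q. Proof. by rewrite SE subrK. Qed.
Lemma F_sub : F - q ^+ 2 / F = d. Proof. by rewrite dE. Qed.
Lemma F2_sub : F ^+ 2 - q ^+ 4 / F ^+ 2 = (S + q) * d.
Proof.
have [K [i inj]] := fps_embeds.
have F1 : i F != 0 by apply: rmorph_neq0 => //; rewrite F0.
rewrite -F_add -F_sub; apply: (inj); push; rewrite !rmorph_unitV ?fcoefX0 ?F0 //; push.
by field.
Qed.

Lemma S_odd n : S (2 * n + 1)%N = 0. Proof. by rewrite S_eta V2_odd. Qed.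

Lemma Sq_odd n : (S + q) (2 * n + 3)%N = 0.
Proof.
by rewrite fcoefD coef_q (_ : 2 * n + 3 = 2 * n.+1 + 1)%N ?S_odd ?addn1 //; lia.
Qed.

Lemma d_2mod4 n : d (4 * n + 2)%N = 0.
Proof.
rewrite d_dissect -[V 4 v](Vcomp 2 2) (_ : 4 * n + 2 = 2 * (2 * n + 1))%N; last by lia.
by rewrite dissect2_even V2_odd.
Qed.

(** The term [2 q ^ 3] of [J_add_dissect] is the only one with exponent 3 modulo 4, so the
    progression starts at 7. *)
Lemma J_add_3mod4 n : (J + q ^+ 6 / J) (4 * n + 7)%N = 0.
Proof.
rewrite J_add_dissect fcoefD coef_nM coef_qX (_ : 4 * n + 7 = 2 * (2 * n.+1 + 1) + 1)%N; last by lia.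
rewrite dissect2_odd V2_odd add0r; case: eqP => //; lia.
Qed.

Lemma J_sub_10mod12 n : (J - q ^+ 6 / J) (12 * n + 10)%N = 0.
Proof.
rewrite J_sub_dissect (_ : 12 * n + 10 = 2 * (2 * (3 * n + 2) + 1))%N; last by lia.
by rewrite dissect2_even dissect2_odd coef_nM v_2mod3.
Qed.

(** The even part of [u * V 2 v] comes from [V 2 k * h], which is $\psi(q)^2\varphi(-q^2)$ times a
    series in [q^3]. The component of the latter at exponents divisible by 3 is [V 2 k] itself, an
    even series. *)
Lemma uv_6mod12 n : (u * V 2 v) (12 * n + 6)%N = 0.
Proof.
have [B wB] := w_dissect; pose k := f3 ^+ 2 / (f2 * f6).
pose h := f2 ^+ 6 / (f1 ^+ 2 * f3 ^+ 2 * f6 ^+ 2).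
have -> : u * V 2 v = V 2 (V 2 k * h) + q * V 2 (B * h).
  have -> : u * V 2 v = w * V 2 h by rewrite /h uE vE wE; push_V; fps_field.
  by rewrite wB -/k; clearbody k h; push; ring.
rewrite (_ : 12 * n + 6 = 2 * (3 * (2 * n + 1)))%N; last by lia.
rewrite dissect2_even.
pose P := f2 * f3 ^+ 2 / (f1 * f6); pose R := f6 ^+ 2 / f3.
pose a := f6 ^+ 2 / f12; pose b := f2 * f12 ^+ 2 / (f4 * f6).
pose m := (f1 ^+ 2 * f4)^-1.
have phi2 : f2 ^+ 2 / f4 = V 3 a - 2 * q ^+ 2 * V 3 b.
  have -> : f2 ^+ 2 / f4 = V 2 (f1 ^+ 2 / f2) by push_V.
  by rewrite phi_dissect3 /a /b; push_V; rewrite Vq //.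
have kE : (P ^+ 2 * a - 4 * q * (P * R * b)) * m = V 2 k.
  apply: (mulIr S_unit1).
  have RE : P * R * b * (S + q) = P ^+ 2 * a.
    by rewrite /P /R /a /b S_add1; fps_field.
  transitivity ((P ^+ 2 * a * (S + q) - 4 * q * (P * R * b * (S + q))) * m); first by ring.
  rewrite RE; transitivity (P ^+ 2 * a * (S - 3 * q) * m); first by ring.
  by rewrite /P /a /m /k S_sub3 S_add1; push_V; fps_field.
have -> : V 2 k * h = V 3 (V 2 k) +
    q * V 3 ((2 * P * R * a - 2 * q * R ^+ 2 * b) * m) +
    q ^+ 2 * V 3 ((R ^+ 2 * a - 2 * P ^+ 2 * b) * m).
  have -> : V 2 k * h = (f2 ^+ 2 / f1) ^+ 2 * (f2 ^+ 2 / f4) * V 3 m.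
    by rewrite /k /h /m; push_V; fps_field.
  rewrite psi_dissect phi2 -/P -/R -kE; clearbody P R a b m.
  by push; rewrite Vq //; ring.
by rewrite dissect3_0 V2_odd.
Qed.

Lemma J_sub_13mod24 n : (J - q ^+ 6 / J) (24 * n + 13)%N = 0.
Proof.
rewrite J_sub_dissect (_ : 24 * n + 13 = 2 * (12 * n + 6) + 1)%N; last by lia.
by rewrite dissect2_odd uv_6mod12.
Qed.

Lemma J_sub_24mod36 n : (J - q ^+ 6 / J) (36 * n + 24)%N = 0.
Proof.
rewrite J_sub_dissect (_ : 36 * n + 24 = 2 * (2 * (9 * n + 6)))%N; last by lia.
by rewrite !dissect2_even v3_6mod9.
Qed.

Lemma int_mulrn_eq0 (a : int) k : a *+ k.+1 = 0 -> a = 0.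
Proof. by move=> /eqP; rewrite Num.Theory.mulrn_eq0 => /eqP. Qed.

(** [Dm] has no exponent 1 modulo 3; removing its factor [2 q ^ 2] shifts this class to 2. *)
Lemma G3_sub_2mod3 n : (G3 - q ^+ 4 / G3) (3 * n + 2)%N = 0.
Proof.
apply: (@int_mulrn_eq0 _ 1); rewrite -coef_2q2M DmE Dm_dissect.
by rewrite (_ : 3 * n + 2 + 2 = 3 * n.+1 + 1)%N ?dissect3_1 //; lia.
Qed.

Lemma G3_sub_7mod12 n : (G3 - q ^+ 4 / G3) (12 * n + 7)%N = 0.
Proof.
apply: (@int_mulrn_eq0 _ 1); rewrite -coef_2q2M DmE Dm_dissect.
rewrite (_ : 12 * n + 7 + 2 = 3 * (4 * n + 2).+1)%N ?dissect3_0; last by lia.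
by rewrite !mulNr fcoefN -mulrA coef_nM coef_qM w_2mod4.
Qed.

Lemma G3_add_2mod6 n : (G3 + q ^+ 4 / G3) (6 * n + 8)%N = 0.
Proof.
apply: (@int_mulrn_eq0 _ 1); rewrite -coef_2q2M DpE Dp_dissect.
rewrite (_ : 6 * n + 8 + 2 = 3 * (2 * n + 1 + 2) + 1)%N ?dissect3_1; last by lia.
rewrite S_eta -VV1 ?u0 // -mulrA coef_nM coef_qXM ltnNge leq_addl addnK.
by rewrite V2_odd.
Qed.

Lemma G3_add_4mod6 n : (G3 + q ^+ 4 / G3) (6 * n + 4)%N = 0.
Proof.
apply: (@int_mulrn_eq0 _ 1); rewrite -coef_2q2M DpE Dp_dissect.
rewrite (_ : 6 * n + 4 + 2 = 3 * (2 * n + 1).+1)%N ?dissect3_0; last by lia.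
rewrite !mulNr fcoefN -mulrA coef_nM coef_qM.
have -> : e0 = V 2 (f3 ^+ 4 / (f2 ^+ 2 * f6 ^+ 2)) by rewrite e0E; push_V.
by rewrite V2_odd.
Qed.

Lemma G3_sq_sub : 4 * (q ^+ 4 * (G3 ^+ 2 - q ^+ 8 / G3 ^+ 2)) = Dp * Dm.
Proof.
have [K [i inj]] := fps_embeds.
have G1 : i G3 != 0 by apply: rmorph_neq0 => //; rewrite G30.
rewrite -DpE -DmE; move: G3 G30 G1 => G G0 G1.
apply: (inj); push; rewrite !rmorph_unitV ?fcoefX0 ?G0 //; push.
by field.
Qed.

Lemma G3_sq_coef n : (G3 ^+ 2 - q ^+ 8 / G3 ^+ 2) n *+ 4 = (Dp * Dm) (n + 4)%N.
Proof. by rewrite -G3_sq_sub coef_nM coef_qXM ltnNge leq_addl addnK. Qed.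

Lemma G3_sq_14mod24 n : (G3 ^+ 2 - q ^+ 8 / G3 ^+ 2) (24 * n + 14)%N = 0.
Proof.
apply: (@int_mulrn_eq0 _ 3); rewrite G3_sq_coef; have [B ->] := DpDm_dissect.
rewrite (_ : 24 * n + 14 + 4 = 3 * (8 * n + 4 + 2))%N ?dissect3_0; last by lia.
by rewrite -mulrA coef_nM coef_qXM ltnNge leq_addl addnK big_4mod8.
Qed.

Lemma G3_sq_25mod36 n : (G3 ^+ 2 - q ^+ 8 / G3 ^+ 2) (36 * n + 25)%N = 0.
Proof.
apply: (@int_mulrn_eq0 _ 3); rewrite G3_sq_coef; have [B ->] := DpDm_dissect.
rewrite (_ : 36 * n + 25 + 4 = 3 * (12 * n + 8).+1 + 2)%N ?dissect3_2; last by lia.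
by rewrite !mulNr fcoefN -mulrA coef_nM coef_qM e2wS_8mod12.
Qed.

Lemma N_even (f : fps) n : N f (2 * n)%N = f (2 * n)%N.
Proof. by rewrite /N exprM sqrrN expr1n mul1r. Qed.
Lemma N_odd (f : fps) n : N f (2 * n + 1)%N = - f (2 * n + 1)%N.
Proof. by rewrite /N exprD exprM sqrrN !expr1n mul1r mulN1r. Qed.

Theorem theorem1p6 (n : nat) :
  xi 1 1 (2 * n + 3)%N = - xi' 1 1 (2 * n + 1)%N /\
  xi 1 1 (4 * n + 2)%N = xi' 1 1 (4 * n)%N /\
  xi 1 1 (6 * n + 2)%N = xi' 1 1 (6 * n)%N /\
  xi 1 2 (12 * n + 7)%N = xi' 1 2 (12 * n + 3)%N /\
  xi 1 2 (24 * n + 12)%N = xi' 1 2 (24 * n + 8)%N /\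
  xi 2 1 (2 * n + 3)%N = - xi' 2 1 (2 * n + 1)%N /\
  xi 2 1 (4 * n + 2)%N = xi' 2 1 (4 * n)%N /\
  xi 2 1 (12 * n + 8)%N = xi' 2 1 (12 * n + 6)%N /\
  xi 2 2 (12 * n + 7)%N = xi' 2 2 (12 * n + 3)%N /\
  xi 2 2 (24 * n + 12)%N = xi' 2 2 (24 * n + 8)%N /\
  xi 3 1 (3 * n + 5)%N = xi' 3 1 (3 * n + 1)%N /\
  xi 3 1 (6 * n + 8)%N = - xi' 3 1 (6 * n + 4)%N /\
  xi 3 1 (6 * n + 4)%N = - xi' 3 1 (6 * n)%N /\
  xi 3 1 (12 * n + 7)%N = xi' 3 1 (12 * n + 3)%N /\
  xi 3 2 (24 * n + 14)%N = xi' 3 2 (24 * n + 6)%N /\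
  xi 3 2 (36 * n + 25)%N = xi' 3 2 (36 * n + 17)%N /\
  xi4 (12 * n + 15)%N = - xi4' (12 * n + 9)%N /\
  xi4 (12 * n + 7)%N = - xi4' (12 * n + 1)%N /\
  xi4 (12 * n + 10)%N = xi4' (12 * n + 4)%N /\
  xi4 (12 * n + 11)%N = - xi4' (12 * n + 5)%N /\
  xi4 (24 * n + 13)%N = xi4' (24 * n + 7)%N /\
  xi4 (36 * n + 24)%N = xi4' (36 * n + 18)%N.

Proof.
(* Since [xi 2 k] is [xi 1 k] at [-q], and likewise for the reciprocals, the claims for [m = 2]
   follow from those for [m = 1]: the two indices in each claim have the same parity. *)
have xi2 k m : ~~ odd m -> xi 2 k m = xi 1 k m /\ xi' 2 k m = xi' 1 k m.
  move=> /negPf m2; rewrite !xi'E xi2E xi1E -NV1 ?fcoefX0 ?F0 ?expr1n //.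
  by rewrite (_ : m = 2 * m./2)%N ?N_even // mul2n -{1}(odd_double_half m) m2.
have xi2' k m : odd m -> xi 2 k m = - xi 1 k m /\ xi' 2 k m = - xi' 1 k m.
  move=> m2; rewrite !xi'E xi2E xi1E -NV1 ?fcoefX0 ?F0 ?expr1n //.
  by rewrite (_ : m = 2 * m./2 + 1)%N ?N_odd // -{1}(odd_double_half m) m2; lia.
have i1 k : xi 1 1 (2 * k + 3)%N = - xi' 1 1 (2 * k + 1)%N.
  rewrite xi'E xi1E; apply: (@inv_coef_add _ 2); first by lia.
  by rewrite F_add Sq_odd.
have i2 k : xi 1 1 (4 * k + 2)%N = xi' 1 1 (4 * k)%N.
  rewrite xi'E xi1E; apply: (@inv_coef_sub _ 2); first by lia.
  by rewrite F_sub d_2mod4.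
have i3 k : xi 1 1 (6 * k + 2)%N = xi' 1 1 (6 * k)%N.
  rewrite xi'E xi1E; apply: (@inv_coef_sub _ 2); first by lia.
  by rewrite F_sub (_ : 6 * k = 3 * (2 * k))%N ?d_2mod3 //; lia.
have i4 k : xi 1 2 (12 * k + 7)%N = xi' 1 2 (12 * k + 3)%N.
  rewrite xi'E xi1E; apply: (@inv_coef_sub _ 4); first by lia.
  by rewrite F2_sub Sd_7mod12.
have i5 k : xi 1 2 (24 * k + 12)%N = xi' 1 2 (24 * k + 8)%N.
  rewrite xi'E xi1E; apply: (@inv_coef_sub _ 4); first by lia.
  by rewrite F2_sub Sd_12mod24.
do 5 (split; first by []).
split.
  have [-> _] : _ /\ _ := xi2' 1%N (2 * n + 3)%N ltac:(lia).
  have [_ ->] : _ /\ _ := xi2' 1%N (2 * n + 1)%N ltac:(lia).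
  by rewrite i1.
split.
  have [-> _] : _ /\ _ := xi2 1%N (4 * n + 2)%N ltac:(lia).
  have [_ ->] : _ /\ _ := xi2 1%N (4 * n)%N ltac:(lia).
  exact: i2.
split.
  have [-> _] : _ /\ _ := xi2 1%N (12 * n + 8)%N ltac:(lia).
  have [_ ->] : _ /\ _ := xi2 1%N (12 * n + 6)%N ltac:(lia).
  (* The third claim at [2 n + 1]; even multiples of 6 are covered as well for [m = 1], but here
     only this half is stated. *)
  have := i3 (2 * n + 1)%N; rewrite (_ : 6 * (2 * n + 1) = 12 * n + 6)%N; last by lia.
  by rewrite -addnA.
split.
  have [-> _] : _ /\ _ := xi2' 2 (12 * n + 7)%N ltac:(lia).
  have [_ ->] : _ /\ _ := xi2' 2 (12 * n + 3)%N ltac:(lia).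
  by rewrite i4.
split.
  have [-> _] : _ /\ _ := xi2 2 (24 * n + 12)%N ltac:(lia).
  have [_ ->] : _ /\ _ := xi2 2 (24 * n + 8)%N ltac:(lia).
  exact: i5.
rewrite !xi'E !xi3E xi4'E xi4E ?expr1; do !split.
- apply: (@inv_coef_sub _ 4); first by lia.
  by rewrite (_ : 3 * n + 5 = 3 * n.+1 + 2)%N ?G3_sub_2mod3 //; lia.
- by apply: (@inv_coef_add _ 4); [lia | rewrite G3_add_2mod6].
- by apply: (@inv_coef_add _ 4); [lia | rewrite G3_add_4mod6].
- by apply: (@inv_coef_sub _ 4); [lia | rewrite G3_sub_7mod12].
- by apply: (@inv_coef_sub _ 8); [lia | rewrite G3_sq_14mod24].
- by apply: (@inv_coef_sub _ 8); [lia | rewrite G3_sq_25mod36].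
(* The indices [12 n + 15], [12 n + 7] and [12 n + 11] are all 3 modulo 4 and at least 7, so one
   vanishing statement gives three claims. *)
- apply: (@inv_coef_add _ 6); first by lia.
  by rewrite (_ : 12 * n + 15 = 4 * (3 * n + 2) + 7)%N ?J_add_3mod4 //; lia.
- apply: (@inv_coef_add _ 6); first by lia.
  by rewrite (_ : 12 * n + 7 = 4 * (3 * n) + 7)%N ?J_add_3mod4 //; lia.
- by apply: (@inv_coef_sub _ 6); [lia | rewrite J_sub_10mod12].
- apply: (@inv_coef_add _ 6); first by lia.
  by rewrite (_ : 12 * n + 11 = 4 * (3 * n + 1) + 7)%N ?J_add_3mod4 //; lia.
- by apply: (@inv_coef_sub _ 6); [lia | rewrite J_sub_13mod24].
- by apply: (@inv_coef_sub _ 6); [lia | rewrite J_sub_24mod36].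
Qed.
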